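(* Let $A^k\in\mathbb{R}^{n_\phi\times n_\phi}$ and $\mathbf v^k\in\mathbb{R}^{n_\phi}$, $k=1,\dots,n_K$, be the local mass (or Poisson) matrices and vectors on the cells of a mesh, let $D=\mathrm{diag}_{k=1}^{n_K}(A^k)$ be the block-diagonal matrix and $\mathbf b$ the vertical stacking of $\mathbf v^1,\dots,\mathbf v^{n_K}$. Let $D$ and $\mathbf b$ be computed in mixed precision with precisions $u_p,u_g,u_q,u_s$, $\max(u_p,u_g,u_q)\le u_s$, sufficiently small, as described in the context, yielding $\hat D$ and $\hat{\mathbf b}$. Let all cell contributions be assembled into the global tensors $A^g=LDL^T$, $\mathbf v^g=L\mathbf b$ in precision $u_q$, where $L\in\{0,1\}^{n_g\times n_\phi n_K}$ is the boolean assembly matrix (at most one nonzero per column). If $L$ has at most $m_K$ nonzero entries per row, then, entrywise, $$|\hat A^g-A^g|\le L|\hat D-D|L^T+2cm_Ku_qL|D|L^T+O\big(u_q(u_s+u_q+u_g+u_p)\big),$$ $$|\hat{\mathbf v}^g-\mathbf v^g|\le L|\hat{\mathbf b}-\mathbf b|+cm_Ku_qL|\mathbf b|+O\big(u_q(u_s+u_q+u_g+u_p)\big),$$ for a constant $c>0$.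
   Context: Floating-point model: in precision $u$ (unit roundoff) every operation satisfies $\mathrm{fl}(a\ \mathrm{op}\ b)=(a\ \mathrm{op}\ b)(1+\delta)$, $|\delta|<u$, $\mathrm{op}\in\{+,-,\times,/\}$; rounding a number to precision $u$ multiplies it by such a factor; no underflow or overflow occurs. Hats denote computed quantities; absolute values and inequalities between tensors are entrywise. $\theta_n$ denotes a generic quantity with $|\theta_n|\le\gamma_n=nu/(1-nu)$. The constant $c$ is such that $\gamma_{m_K}=m_Ku_q/(1-m_Ku_q)\le cm_Ku_q$; constants in $O(\cdot)$ may depend on all data except the unit roundoffs. Mesh coordinates and quadrature rules carry no error other than rounding to the working precision. $n_g$ is the number of global degrees of freedom, $L$ encodes the local-to-global map, and $m_K$ is the maximum number of local degrees of freedom corresponding to the same global one. Local computation on each cell: precision $u_p$ is used to tabulate and evaluate basis functions and functions in the FE space; $u_g$ to compute the geometry tensor $G$ and to form $C$ and $\mathbf r_s$ (from values of FE functions cast to $u_g$); $u_q$ to perform and accumulate the products into $A$ and $\mathbf v$; $u_s$ to store (round to) $B$, $\mathbf r_s$, $C$ and to compute $H$. Here, for each non-degenerate cell $K$ (simplex or boxed cell of a first-order mesh in $\mathbb{R}^d$, with vertices $x^k$), $\check K$ is the reference cell with degree-1 Lagrange basis $\check\psi_k$; $J_{ij}(x)=\sum_k x_i^k\partial_j\check\psi_k(x)$; mass form: $n_d=1$, $G=|\det J|$; Poisson form: $n_d=d$, $G=|\det J|J^{-1}J^{-T}$. $G$ is evaluated by computing $\hat J$ from this sum, $\det$ by LU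 factorization of $\hat J$ (as in LAPACK), and $J^{-1}$ by an algorithm which, for input $M\in\mathbb{R}^{n\times n}$, satisfies $|\widehat{M^{-1}}-M^{-1}|\le c(n)u_g|M^{-1}||M||M^{-1}|$. $\Phi=[\phi_k]_{k=1}^{n_\phi}$ is the degree-$p$ nodal Lagrange basis on $\check K$; each $\phi_k=w_k\prod_{l=1}^m\ell_{k,l}$ is a product of first-degree factors and a known constant ($m=pd$ on boxed cells, $m=p$ on simplices), each factor being evaluated with relative error factor $1+\theta_r$ ($r=O(1)$ on boxed cells, $r=O(d)$ on simplices); $\phi_k$ is evaluated as this product, $\partial_s\phi_k$ by $w_k\sum_j(\partial_s\ell_{k,j})\prod_{l\neq j}\ell_{k,l}$, and FE functions and derivatives as inner products of coefficients and basis values. With quadrature $\{(\omega_q,x_q)\}_{q=1}^{n_q}$ on $\check K$, $\check z=\mathbf z^T\Phi$ and $\check w=\mathbf w^T\Phi$: $C_{st}=\mathrm{diag}_q(\omega_qG_{st}(x_q)\check z(x_q))$; $B_{skq}=\phi_k(x_q)$ (mass) or $\partial_s\phi_k(x_q)$ (Poisson); $H_{st}=C_{st}B_t^T$; $\mathbf r_s$ has $q$-th entry $\omega_q\check z(x_q)G(x_q)\check w(x_q)$ (mass) or $\omega_q\check z(x_q)(G(x_q)\nabla\check w(x_q))_s$ (Poisson); the local matrix and vector are $A=\sum_{s,t=1}^{n_d}B_sH_{st}$ and $\mathbf v=\sum_{s=1}^{n_d}B_s\mathbf r_s$. *)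

(* Defs.v *)
From HB Require Import structures.
From mathcomp Require Import all_boot all_order all_algebra.
From mathcomp Require Import mpoly.

Set Implicit Arguments.
Unset Strict Implicit.
Unset Printing Implicit Defensive.

Import Order.TTheory GRing.Theory Num.Theory.
Local Open Scope ring_scope.

(* A floating-point computation is a relation between its data and its last
   argument, which is a possible computed value; each elementary operation
   carries its own rounding error. *)
Section FloatingPoint.
Variable R : realFieldType.
Implicit Types (u x y : R) (n : nat).

(* [y] is the real number [x] after one rounding; fl(a op b) is [fl u (a op b)],
   and [fl u a] is the cast of [a] to precision [u]. *)
Definition fl u x y : Prop := exists2 e : R, `|e| < u & y = x * (1 + e).

Definition gamma n u : R := n%:R * u / (1 - n%:R * u).

Definition fl_theta u n x y : Prop :=
  exists2 t : R, `|t| <= gamma n u & y = x * (1 + t).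

(* Reduction of a list in an arbitrary order and bracketing. Both parts of a
   node are nonempty, so that [n] terms cost exactly [n - 1] operations. *)
Inductive fl_reduce (op : R -> R -> R) (idx : R) u : seq R -> R -> Prop :=
| fl_reduce_nil : fl_reduce op idx u [::] idx
| fl_reduce_one x : fl_reduce op idx u [:: x] x
| fl_reduce_node s s1 s2 x1 x2 y :
    perm_eq s (s1 ++ s2) -> s1 != [::] -> s2 != [::] ->
    fl_reduce op idx u s1 x1 -> fl_reduce op idx u s2 x2 ->
    fl u (op x1 x2) y -> fl_reduce op idx u s y.

Definition fl_sum u : seq R -> R -> Prop := fl_reduce +%R 0 u.
Definition fl_prod u : seq R -> R -> Prop := fl_reduce *%R 1 u.

Definition fl_dot u (I : finType) (P : pred I) (a b : I -> R) y : Prop :=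
  exists2 t : I -> R, (forall i, fl u (a i * b i) (t i)) &
    fl_sum u [seq t i | i in P] y.

(* Gaussian elimination with partial pivoting: [ds] lists the pivots, and [sg]
   is the parity of the number of row exchanges. If a whole pivot column is
   zero then, as x / 0 = 0, the multipliers vanish and the step is skipped. *)
Fixpoint fl_lu u n : 'M[R]_n -> bool -> seq R -> Prop :=
  match n return 'M[R]_n -> bool -> seq R -> Prop with
  | 0 => fun _ sg ds => sg = false /\ ds = [::]
  | n'.+1 => fun M sg ds =>
      exists (i : 'I_n'.+1) (l : 'I_n' -> R) (P S : 'M[R]_n') (sg' : bool)
             (ds' : seq R),
      let N := xrow i ord0 M in
      (forall k, `|M k ord0| <= `|M i ord0|) /\
      (forall k, fl u (N (lift ord0 k) ord0 / N ord0 ord0) (l k)) /\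
      (forall k j, fl u (l k * N ord0 (lift ord0 j)) (P k j)) /\
      (forall k j, fl u (N (lift ord0 k) (lift ord0 j) - P k j) (S k j)) /\
      fl_lu u S sg' ds' /\
      sg = (i != ord0) (+) sg' /\
      ds = N ord0 ord0 :: ds'
  end.

Definition fl_det u n (M : 'M[R]_n) y : Prop :=
  exists (sg : bool) (ds : seq R) (x : R),
    [/\ fl_lu u M sg ds, fl_prod u ds x & y = (-1) ^+ sg * x].

Definition absmx m n (A : 'M[R]_(m, n)) : 'M[R]_(m, n) :=
  map_mx (fun x => `|x|) A.

Definition fl_inv (cinv : nat -> R) u n (M Mi : 'M[R]_n) : Prop :=
  M \in unitmx -> forall i j,
  `|Mi i j - invmx M i j| <=
    cinv n * u * (absmx (invmx M) *m absmx M *m absmx (invmx M)) i j.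

(* Products with a 0/1 matrix [L] only visit the nonzero entries of [L]. *)
Definition fl_boolmul u m n q (L : 'M[R]_(m, n)) (M : 'M[R]_(n, q))
    (P : 'M[R]_(m, q)) : Prop :=
  forall i j, fl_dot u [pred k | L i k != 0] (L i) (fun k => M k j) (P i j).

(* L M L^T, computed either as (L M) L^T or as L (M L^T). *)
Definition fl_assemble u m n (L : 'M[R]_(m, n)) (M : 'M[R]_n)
    (A : 'M[R]_m) : Prop :=
  (exists2 P, fl_boolmul u L M P & fl_boolmul u L P^T A^T) \/
  (exists2 P, fl_boolmul u L M^T P & fl_boolmul u L P^T A).

Definition boolean_assembly m n (L : 'M[R]_(m, n)) : Prop :=
  (forall i j, L i j = 0 \/ L i j = 1) /\
  (forall j, (#|[set i | L i j != 0%R]| <= 1)%N).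

End FloatingPoint.

Inductive cell_shape := Simplex | Box.

Inductive weak_form := Mass | Poisson.

Definition form_dim (f : weak_form) (d : nat) : nat :=
  match f with Mass => 1 | Poisson => d end.

Definition space_dim (sh : cell_shape) (d p : nat) : nat :=
  match sh with Simplex => 'C(p + d, d)%N | Box => (p.+1 ^ d)%N end.

Definition nfactors (sh : cell_shape) (d p : nat) : nat :=
  match sh with Simplex => p | Box => (p * d)%N end.

Section FiniteElement.
Variable R : realFieldType.

(* The unit simplex and the unit box. *)
Definition ref_cell (sh : cell_shape) d (x : 'I_d -> R) : Prop :=
  match sh with
  | Simplex => (forall i, 0 <= x i) /\ \sum_i x i <= 1
  | Box => forall i, 0 <= x i <= 1
  end.

(* P_p on the simplex, Q_p on the box. *)
Definition in_space (sh : cell_shape) d p (g : {mpoly R[d]}) : Prop :=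
  match sh with
  | Simplex => (msize g <= p.+1)%N
  | Box => forall m, m \in msupp g -> forall i, (m i <= p)%N
  end.

(* A nodal Lagrange basis of degree [p], given with its factorisation. *)
Record lagrange_basis (sh : cell_shape) (d p : nat) := Lagrange {
  lag_const : 'I_(space_dim sh d p) -> R;
  lag_factor : 'I_(space_dim sh d p) -> 'I_(nfactors sh d p) -> {mpoly R[d]};
  lag_node : 'I_(space_dim sh d p) -> 'I_d -> R;
  lag : 'I_(space_dim sh d p) -> {mpoly R[d]} :=
    fun k => lag_const k *: \prod_l lag_factor k l;
  lag_factor_deg : forall k l, msize (lag_factor k l) = 2;
  lag_space : forall k, in_space sh p (lag k);
  lag_node_cell : forall k, ref_cell sh (lag_node k);
  lag_nodal : forall k j, (lag k).@[lag_node j] = (k == j)%:R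
}.

(* The [geom_basis] nodes are the vertices of the reference cell: they are
   pairwise distinct, have 0/1 coordinates, and are as many as the vertices. *)
Record reference (sh : cell_shape) (d p nq : nat) := Reference {
  fe_basis : lagrange_basis sh d p;
  geom_basis : lagrange_basis sh d 1;
  geom_basis_vertex : forall k i,
    lag_node geom_basis k i = 0 \/ lag_node geom_basis k i = 1;
  qweight : 'I_nq -> R;
  qpoint : 'I_nq -> 'I_d -> R;
  qpoint_cell : forall q, ref_cell sh (qpoint q)
}.

(* [vertex i k] is the i-th coordinate of the k-th vertex. *)
Record cell (sh : cell_shape) (d p : nat) := Cell {
  vertex : 'M[R]_(d, space_dim sh d 1);
  zcoef : 'I_(space_dim sh d p) -> R;
  wcoef : 'I_(space_dim sh d p) -> R
}.

Section Local.
Variables (f : weak_form) (sh : cell_shape) (d p nq : nat).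
Variables (E : reference sh d p nq) (K : cell sh d p).
Notation nphi := (space_dim sh d p).
Notation nd := (form_dim f d).

Definition jacobian (x : 'I_d -> R) : 'M[R]_d :=
  \matrix_(i, j) \sum_k vertex K i k * ((lag (geom_basis E) k)^`M(j)).@[x].

Definition nondegenerate_cell : Prop :=
  forall x, ref_cell sh x -> \det (jacobian x) != 0.

Definition geometry (x : 'I_d -> R) : 'M[R]_nd :=
  let J := jacobian x in
  match f return 'M[R]_(form_dim f d) with
  | Mass => (`|\det J|)%:M
  | Poisson => `|\det J| *: (invmx J *m (invmx J)^T)
  end.

(* s-th component of g (mass) or of its gradient (Poisson). *)
Definition component (g : {mpoly R[d]}) (s : 'I_nd) : {mpoly R[d]} :=
  match f return 'I_(form_dim f d) -> {mpoly R[d]} with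
  | Mass => fun _ => g
  | Poisson => fun s => g^`M(s)
  end s.

Definition fe_fun (c : 'I_nphi -> R) : {mpoly R[d]} :=
  \sum_k c k *: lag (fe_basis E) k.

Definition Bmx (s : 'I_nd) : 'M[R]_(nphi, nq) :=
  \matrix_(k, q) (component (lag (fe_basis E) k) s).@[qpoint E q].

Definition Cmx (s t : 'I_nd) : 'M[R]_nq :=
  diag_mx (\row_q (qweight E q * geometry (qpoint E q) s t *
                   (fe_fun (zcoef K)).@[qpoint E q])).

Definition Hmx (s t : 'I_nd) : 'M[R]_(nq, nphi) := Cmx s t *m (Bmx t)^T.

Definition rvec (s : 'I_nd) : 'cV[R]_nq :=
  \col_q (qweight E q * (fe_fun (zcoef K)).@[qpoint E q] *
    \sum_t geometry (qpoint E q) s t *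
           (component (fe_fun (wcoef K)) t).@[qpoint E q]).

Definition local_matrix : 'M[R]_nphi := \sum_s \sum_t Bmx s *m Hmx s t.
Definition local_vector : 'cV[R]_nphi := \sum_s Bmx s *m rvec s.

End Local.

Section ComputedBasis.
Variables (sh : cell_shape) (d p : nat) (F : lagrange_basis sh d p).
Variables (r : nat) (u : R).

Definition fl_factors k (x : 'I_d -> R) (l : 'I_(nfactors sh d p) -> R) : Prop :=
  forall i, fl_theta u r (lag_factor F k i).@[x] (l i).

Definition fl_lag k (x : 'I_d -> R) (y : R) : Prop :=
  exists (w : R) (l : 'I_(nfactors sh d p) -> R),
    [/\ fl u (lag_const F k) w, fl_factors k x l &
        fl_prod u (w :: [seq l i | i : 'I_(nfactors sh d p)]) y].

Definition fl_dlag k (s : 'I_d) (x : 'I_d -> R) (y : R) : Prop :=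
  exists (w a : R) (l dl t : 'I_(nfactors sh d p) -> R),
    fl u (lag_const F k) w /\ fl_factors k x l /\
    (forall j, fl u ((lag_factor F k j)^`M(s)).@[x] (dl j)) /\
    (forall j, fl_prod u (dl j :: [seq l i | i in predC1 j]) (t j)) /\
    fl_sum u [seq t j | j : 'I_(nfactors sh d p)] a /\
    fl u (w * a) y.

Definition fl_component (f : weak_form) k (s : 'I_(form_dim f d))
    (x : 'I_d -> R) (y : R) : Prop :=
  match f return 'I_(form_dim f d) -> Prop with
  | Mass => fun _ => fl_lag k x y
  | Poisson => fun s => fl_dlag k s x y
  end s.

End ComputedBasis.

Section ComputedLocal.
Variables (f : weak_form) (sh : cell_shape) (d p nq : nat).
Variables (E : reference sh d p nq) (K : cell sh d p).
Variables (r : nat) (cinv : nat -> R) (up ug uq us : R).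
Notation nphi := (space_dim sh d p).
Notation nd := (form_dim f d).

Definition fl_jacobian (x : 'I_d -> R) (J : 'M[R]_d) : Prop :=
  exists (X : 'M[R]_(d, space_dim sh d 1)) (D : 'M[R]_(space_dim sh d 1, d)),
    [/\ forall i k, fl ug (vertex K i k) (X i k),
        forall k j, fl_dlag (geom_basis E) r ug k j x (D k j) &
        forall i j, fl_dot ug predT (X i) (fun k => D k j) (J i j)].

Definition fl_geometry (x : 'I_d -> R) (G : 'M[R]_nd) : Prop :=
  exists (J : 'M[R]_d) (dJ : R),
    [/\ fl_jacobian x J, fl_det ug J dJ &
      match f return 'M[R]_(form_dim f d) -> Prop with
      | Mass => fun G => G = `|dJ|%:M
      | Poisson => fun G =>
          exists (Ji S : 'M[R]_d),
            [/\ fl_inv cinv ug J Ji,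
                forall s t, fl_dot ug predT (Ji s) (Ji t) (S s t) &
                forall s t, fl ug (`|dJ| * S s t) (G s t)]
      end G].

(* FE values computed in precision [up] and then cast to [ug]. *)
Definition fl_fe_value (c : 'I_nphi -> R) (x : 'I_d -> R) (y : R) : Prop :=
  exists (b : 'I_nphi -> R) (a : R),
    [/\ forall k, fl_lag (fe_basis E) r up k x (b k),
        fl_dot up predT c b a & fl ug a y].

Definition fl_fe_deriv (c : 'I_nphi -> R) (s : 'I_d) (x : 'I_d -> R) (y : R)
    : Prop :=
  exists (b : 'I_nphi -> R) (a : R),
    [/\ forall k, fl_dlag (fe_basis E) r up k s x (b k),
        fl_dot up predT c b a & fl ug a y].

Definition fl_Bmx (s : 'I_nd) (B : 'M[R]_(nphi, nq)) : Prop :=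
  forall k q, exists2 b : R,
    fl_component (fe_basis E) r up k s (qpoint E q) b & fl us b (B k q).

(* [C] is the diagonal of C_st. *)
Definition fl_Cdiag (s t : 'I_nd) (C : 'I_nq -> R) : Prop :=
  forall q, exists (w z a : R) (G : 'M[R]_nd),
    fl ug (qweight E q) w /\ fl_geometry (qpoint E q) G /\
    fl_fe_value (zcoef K) (qpoint E q) z /\
    fl_prod ug [:: w; G s t; z] a /\ fl us a (C q).

Definition fl_rvec (s : 'I_nd) (rv : 'cV[R]_nq) : Prop :=
  forall q, exists (w z a : R) (G : 'M[R]_nd),
    fl ug (qweight E q) w /\ fl_geometry (qpoint E q) G /\
    fl_fe_value (zcoef K) (qpoint E q) z /\
    match f return 'M[R]_(form_dim f d) -> 'I_(form_dim f d) -> Prop with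
    | Mass => fun G s =>
        exists2 v : R, fl_fe_value (wcoef K) (qpoint E q) v &
          fl_prod ug [:: w; z; G s s; v] a
    | Poisson => fun G s =>
        exists (dv : 'I_d -> R) (g : R),
          [/\ forall t, fl_fe_deriv (wcoef K) t (qpoint E q) (dv t),
              fl_dot ug predT (G s) dv g & fl_prod ug [:: w; z; g] a]
    end G s /\
    fl us a (rv q 0).

Definition fl_local_matrix (A : 'M[R]_nphi) : Prop :=
  exists (B : 'I_nd -> 'M[R]_(nphi, nq)) (C : 'I_nd -> 'I_nd -> 'I_nq -> R)
         (H : 'I_nd -> 'I_nd -> 'M[R]_(nq, nphi)),
    [/\ forall s, fl_Bmx s (B s),
        forall s t, fl_Cdiag s t (C s t),
        forall s t q k, fl us (C s t q * B t k q) (H s t q k) &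
        forall i j, @fl_dot R uq ('I_nd * 'I_nd * 'I_nq)%type predT
          (fun a => B a.1.1 i a.2) (fun a => H a.1.1 a.1.2 a.2 j) (A i j)].

Definition fl_local_vector (v : 'cV[R]_nphi) : Prop :=
  exists (B : 'I_nd -> 'M[R]_(nphi, nq)) (rv : 'I_nd -> 'cV[R]_nq),
    [/\ forall s, fl_Bmx s (B s),
        forall s, fl_rvec s (rv s) &
        forall i, @fl_dot R uq ('I_nd * 'I_nq)%type predT
          (fun a => B a.1 i a.2) (fun a => rv a.1 a.2 0) (v i 0)].

End ComputedLocal.

End FiniteElement.

(* Main.v *)
Require Import Defs.
From HB Require Import structures.
From mathcomp Require Import all_boot all_order all_algebra.
From mathcomp Require Import perm mpoly ring lra.
From Stdlib Require Import IndefiniteDescription.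

Set Implicit Arguments.
Unset Strict Implicit.
Unset Printing Implicit Defensive.

Import Order.TTheory GRing.Theory Num.Theory.
Local Open Scope ring_scope.

(** The global error splits as
    [L Dh L^T - L D L^T] plus the rounding errors of the two boolean products.
    The first part is at most [L |Dh - D| L^T], because [L] is nonnegative. In
    the second, every entry is a reduction of at most [mK] products, so one
    boolean product costs a relative error [gamma mK uq], and two of them cost
    [2 gamma + gamma^2] times [L |Dh| L^T], which is at most
    [L |D| L^T + L |Dh - D| L^T]. The term [2 gamma L |D| L^T] is the announced
    one; [gamma^2] is quadratic in [uq]; so everything is settled once
    [Dh - D] is known to be of first order in the unit roundoffs, since it is
    then multiplied by one more factor [uq].

    That last fact ([accurate_fl_local_matrix], [accurate_fl_local_vector]) is
    the long part. No explicit constant is needed, so it is obtained from a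
    small calculus: a computed quantity is a function on a type of runs, and
    [accurate u F x] says that it is within [C * u] of [x], uniformly over all
    runs with [u] small. This is stable under the field operations and under
    one more rounding, so each computed quantity is treated by following its
    formula. Two steps are not of this kind. The LU factorisation branches on
    the computed entries; its runs are split by the first pivot row, where a
    row whose exact entry vanishes cannot be selected for small [u], and on
    each remaining branch the exact elimination step is well defined
    ([accurate_lu]). The error bound of the inversion algorithm concerns the
    computed Jacobian, whose inverse is near the exact one because the
    determinant stays away from zero ([accurate_fl_inv]). Nondegeneracy of the
    cells enters exactly in these two places. *)

(** * Rounding errors of reductions *)

Section ErrorBounds.
Variable R : realFieldType.
Implicit Types (u x y : R) (s : seq R).

(** The error bound natural to an induction on reductions; [gamma] is recovered
    from it at the end by [accum_gamma]. *)
Definition accum n u : R := (1 + u) ^+ n - 1.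

Lemma accum_ge0 n u : 0 <= u -> 0 <= accum n u.
Proof. by move=> u0; rewrite subr_ge0 exprn_ege1 // lerDl. Qed.

Lemma accumS n u : accum n.+1 u = accum n u * (1 + u) + u.
Proof. by rewrite /accum exprSr; ring. Qed.

Lemma le_accum m n u : 0 <= u -> (m <= n)%N -> accum m u <= accum n u.
Proof. by move=> u0 mn; rewrite lerD2r ler_weXn2l // lerDl. Qed.

(** Induction on [n]: after clearing denominators, one more factor [1 + u] costs
    at most [u], because [(1 + u) (1 - n u - u) <= 1 - n u]. *)
Lemma accum_gamma n u : 0 <= u -> n%:R * u < 1 -> accum n u <= gamma n u.
Proof.
rewrite /gamma => u0; elim: n => [|n IH]; first by rewrite /accum expr0; lra.
move=> nu; have n0 : 0 <= n%:R :> R by exact: ler0n.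
have nS : n.+1%:R = n%:R + 1 :> R by rewrite -natr1.
have p : 0 < 1 - n.+1%:R * u by rewrite subr_gt0.
have q : 0 < 1 - n%:R * u by rewrite nS in p; nra.
have {}IH : accum n u * (1 - n%:R * u) <= n%:R * u.
  by rewrite -ler_pdivlMr //; apply: IH; lra.
rewrite ler_pdivlMr // accumS.
move: IH (accum_ge0 n u0) (mulr_ge0 n0 u0); rewrite nS.
set a := accum n u; rewrite (mulrDl n%:R 1 u) mul1r; set N := n%:R * u => IH a0 N0.
have := mulr_ge0 a0 (mulr_ge0 N0 u0); have := mulr_ge0 a0 (mulr_ge0 u0 u0).
by have := mulr_ge0 N0 u0; have := mulr_ge0 u0 u0; lra.
Qed.

Lemma gamma_linear n u : 0 <= u -> n%:R * u <= 1 / 2 -> gamma n u <= 2 * n%:R * u.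
Proof.
move=> u0; have := mulr_ge0 (ler0n R n) u0.
rewrite /gamma -(mulrA 2); set N := n%:R * u => N0 N2.
by rewrite ler_pdivrMr; [nra | lra].
Qed.

Lemma accum_linear n u : 0 <= u -> n%:R * u <= 1 / 2 -> accum n u <= 2 * n%:R * u.
Proof.
by move=> u0 nu; apply: le_trans (gamma_linear u0 nu); apply: accum_gamma => //; lra.
Qed.

Lemma fl_err u x y : fl u x y -> `|y - x| <= u * `|x|.
Proof.
case=> e eu ->; rewrite (_ : _ - _ = e * x); last by ring.
by rewrite normrM ler_wpM2r // ltW.
Qed.

(** An addition puts at most one factor [1 + u] on top of the longer of the two
    branches below it; since both are nonempty, a tree with [n] leaves has depth
    at most [n - 1], whatever its shape. *)
Lemma fl_sum_err u s y : 0 <= u -> fl_sum u s y ->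
  `|y - \sum_(x <- s) x| <= accum (size s).-1 u * \sum_(x <- s) `|x|.
Proof.
move=> u0; elim=> {s y} [|x|s s1 s2 x1 x2 y ps n1 n2 _ IH1 _ IH2 /fl_err H].
- by rewrite !big_nil subrr normr0 mulr0.
- by rewrite !big_seq1 subrr normr0 /accum expr0 subrr mul0r.
rewrite !(perm_big _ ps) (perm_size ps) !big_cat size_cat /=.
move: IH1 IH2; case: s1 n1 {ps} => // a1 s1 _; case: s2 n2 => // a2 s2 _.
set S1 := \sum_(x <- _) x; set S2 := \sum_(x <- _ :: s2) x.
set T1 := \sum_(x <- _) `|x|; set T2 := \sum_(x <- _ :: s2) `|x| => IH1 IH2.
have T10 : 0 <= T1 by apply: sumr_ge0.
have T20 : 0 <= T2 by apply: sumr_ge0.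
have ST1 : `|S1| <= T1 by apply: ler_norm_sum.
have ST2 : `|S2| <= T2 by apply: ler_norm_sum.
rewrite /= addnS accumS.
set g := accum _ u.
have {}IH1 : `|x1 - S1| <= g * T1.
  by apply: le_trans IH1 _; rewrite ler_wpM2r // le_accum // leq_addr.
have {}IH2 : `|x2 - S2| <= g * T2.
  by apply: le_trans IH2 _; rewrite ler_wpM2r // le_accum // leq_addl.
have g0 : 0 <= g by apply: accum_ge0.
have E : `|x1 + x2 - (S1 + S2)| <= g * (T1 + T2).
  rewrite (_ : _ - _ = (x1 - S1) + (x2 - S2)); last by ring.
  by apply: le_trans (ler_normD _ _) _; lra.
have ST : `|S1 + S2| <= T1 + T2 by apply: le_trans (ler_normD _ _) _; lra.
have X : `|x1 + x2| <= (1 + g) * (T1 + T2).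
  rewrite -[x1 + x2](subrK (S1 + S2)); apply: le_trans (ler_normD _ _) _; lra.
rewrite -[y](subrK (x1 + x2)) -addrA; apply: le_trans (ler_normD _ _) _.
have := ler_wpM2l u0 X; lra.
Qed.

(** Relative errors multiply, so here the exponents of [1 + u] add up to the
    number [n - 1] of nodes exactly. *)
Lemma fl_prod_err u s y : 0 <= u -> fl_prod u s y ->
  `|y - \prod_(x <- s) x| <= accum (size s).-1 u * `|\prod_(x <- s) x|.
Proof.
move=> u0; elim=> {s y} [|x|s s1 s2 x1 x2 y ps n1 n2 _ IH1 _ IH2 /fl_err H].
- by rewrite !big_nil subrr normr0 /accum expr0 subrr mul0r.
- by rewrite !big_seq1 subrr normr0 /accum expr0 subrr mul0r.
rewrite !(perm_big _ ps) (perm_size ps) !big_cat size_cat /=.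
move: IH1 IH2; case: s1 n1 {ps} => // a1 s1 _; case: s2 n2 => // a2 s2 _.
set P1 := \prod_(x <- _) x; set P2 := \prod_(x <- _ :: s2) x => IH1 IH2.
rewrite /= addnS accumS.
rewrite (_ : accum (size s1 + _) u = accum (size s1) u * (1 + accum (size s2) u)
   + accum (size s2) u); last by rewrite /accum exprD; ring.
move: IH1 IH2; rewrite /= normrM.
set g1 := accum (size s1) u; set g2 := accum (size s2) u => IH1 IH2.
have g10 : 0 <= g1 by apply: accum_ge0.
have g20 : 0 <= g2 by apply: accum_ge0.
have X2 : `|x2| <= (1 + g2) * `|P2|.
  by rewrite -[x2](subrK P2); apply: le_trans (ler_normD _ _) _; lra.
have E : `|x1 * x2 - P1 * P2| <= (g1 * (1 + g2) + g2) * (`|P1| * `|P2|).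
  rewrite (_ : _ - _ = (x1 - P1) * x2 + P1 * (x2 - P2)); last by ring.
  apply: le_trans (ler_normD _ _) _; rewrite !normrM.
  have := ler_pM (normr_ge0 _) (normr_ge0 _) IH1 X2.
  have := ler_wpM2l (normr_ge0 P1) IH2; lra.
set g := g1 * _ + g2 in E *.
have X : `|x1 * x2| <= (1 + g) * (`|P1| * `|P2|).
  rewrite -[x1 * x2](subrK (P1 * P2)); apply: le_trans (ler_normD _ _) _.
  by rewrite (normrM P1); lra.
rewrite -[y](subrK (x1 * x2)) -addrA; apply: le_trans (ler_normD _ _) _.
have := ler_wpM2l u0 X; lra.
Qed.

Lemma fl_dot_err u (I : finType) (P : pred I) (a b : I -> R) y :
  0 <= u -> fl_dot u P a b y ->
  `|y - \sum_(i | P i) a i * b i| <=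
    accum #|P| u * \sum_(i | P i) `|a i * b i|.
Proof.
move=> u0 [t tE] /(fl_sum_err u0).
rewrite size_map -cardE !big_map !big_enum /=.
have inP F : \sum_(i in P) F i = \sum_(i | P i) F i :> R by apply: eq_bigl.
rewrite !inP; set S := \sum_(i | _) t i; set A := \sum_(i | _) `|t i|.
set B := \sum_(i | _) a i * b i; set C := \sum_(i | _) `|_|.
case n0 : #|P| => [|n] /=.
  by rewrite /accum expr0 subrr !mul0r /S /B !big_pred0 //= => i; apply: (card0_eq n0 i).
move=> H; rewrite accumS.
have C0 : 0 <= C by apply: sumr_ge0.
have SB : `|S - B| <= u * C.
  rewrite -sumrB mulr_sumr; apply: le_trans (ler_norm_sum _ _ _) _.
  by apply: ler_sum => i _; apply: fl_err.
have AC : A <= (1 + u) * C.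
  rewrite mulr_sumr; apply: ler_sum => i _; have := fl_err (tE i).
  by rewrite -{2}[t i](subrK (a i * b i)) => E; apply: le_trans (ler_normD _ _) _; lra.
rewrite -[y](subrK S) -addrA; apply: le_trans (ler_normD _ _) _.
have := ler_wpM2l (accum_ge0 n u0) AC; lra.
Qed.

End ErrorBounds.

(** * A calculus of first-order errors *)

Section Accuracy.
Variables (R : realFieldType) (T : Type) (u : T -> R).
Implicit Types (F G B v : T -> R) (x y b : R).

(** [T] is a type of runs of an algorithm, [u t] bounds the unit roundoffs of
    the run [t], and [F t] is a number computed in it. The constants precede [t]:
    this is [F = x + O(u)], uniformly over the runs. *)
Definition accurate F x : Prop :=
  exists C u0, [/\ 0 <= C, 0 < u0 &
    forall t, 0 <= u t <= u0 -> `|F t - x| <= C * u t].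

Definition precision v : Prop := forall t, 0 <= v t <= u t.

Lemma accurate_eq F G x y : F =1 G -> x = y -> accurate F x -> accurate G y.
Proof.
by move=> FG <- [C [u0 [C0 u00 H]]]; exists C, u0; split=> // t /H; rewrite FG.
Qed.

Lemma accurate_const x : accurate (fun=> x) x.
Proof. by exists 0, 1; split=> // t _; rewrite subrr normr0 mul0r. Qed.

Lemma accurate_bounded F x : accurate F x ->
  exists M u0, [/\ 0 <= M, 0 < u0 & forall t, 0 <= u t <= u0 -> `|F t| <= M].
Proof.
move=> [C [u0 [C0 u00 H]]]; exists (C * u0 + `|x|), u0; split=> //.
  by rewrite addr_ge0 ?mulr_ge0 // ltW.
move=> t ut; rewrite -[F t](subrK x); apply: le_trans (ler_normD _ _) _.
rewrite lerD2r; apply: le_trans (H _ ut) _; rewrite ler_wpM2l //.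
by case/andP: ut.
Qed.

(** The only way in which rounding enters the calculus: an error relative to a
    quantity [B] that stays bounded preserves accuracy. *)
Lemma accurate_err F G B x b :
    (exists c u1, [/\ 0 <= c, 0 < u1 &
       forall t, 0 <= u t <= u1 -> `|G t - F t| <= c * u t * `|B t|]) ->
  accurate F x -> accurate B b -> accurate G x.
Proof.
move=> [c [u1 [c0 u10 HG]]] [C [u2 [C0 u20 HF]]] /accurate_bounded.
move=> [M [u3 [M0 u30 HB]]].
exists (c * M + C), (Num.min u1 (Num.min u2 u3)); split.
- by rewrite addr_ge0 // mulr_ge0.
- by rewrite !lt_min u10 u20.
move=> t; rewrite !le_min => /and4P[u0 t1 t2 t3].
rewrite -[G t](subrK (F t)) -addrA; apply: le_trans (ler_normD _ _) _.
rewrite mulrDl lerD // ?HF ?u0 //; apply: le_trans (HG t _) _; first by rewrite u0.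
rewrite -[leRHS]mulrA [M * _]mulrC mulrA ler_wpM2l ?mulr_ge0 //.
by rewrite HB // u0.
Qed.

Lemma accurateD F G x y :
  accurate F x -> accurate G y -> accurate (fun t => F t + G t) (x + y).
Proof.
move=> [C [u1 [C0 u10 HF]]] [D [u2 [D0 u20 HG]]].
exists (C + D), (Num.min u1 u2); split; rewrite ?addr_ge0 ?lt_min ?u10 //.
move=> t; rewrite le_min => /and3P[u0 t1 t2].
rewrite opprD addrACA mulrDl; apply: le_trans (ler_normD _ _) _.
by rewrite lerD ?HF ?HG ?u0.
Qed.

Lemma accurateM F G x y :
  accurate F x -> accurate G y -> accurate (fun t => F t * G t) (x * y).
Proof.
move=> FA [D [u2 [D0 u20 HG]]].
have [M [u3 [M0 u30 HM]]] := accurate_bounded FA.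
case: FA => C [u1 [C0 u10 HF]].
exists (M * D + C * `|y|), (Num.min u1 (Num.min u2 u3)); split.
- by rewrite addr_ge0 // mulr_ge0.
- by rewrite !lt_min u10 u20.
move=> t; rewrite !le_min => /and4P[u0 t1 t2 t3].
rewrite (_ : _ - _ = F t * (G t - y) + (F t - x) * y); last by ring.
apply: le_trans (ler_normD _ _) _; rewrite !normrM mulrDl lerD //.
  by rewrite -[leRHS]mulrA ler_pM // ?HM ?HG ?u0.
by rewrite mulrAC ler_wpM2r // HF // u0.
Qed.

Lemma accurateN F x : accurate F x -> accurate (fun t => - F t) (- x).
Proof.
move=> [C [u0 [C0 u00 H]]]; exists C, u0; split=> // t /H.
by rewrite -opprD normrN.
Qed.

Lemma accurateB F G x y :
  accurate F x -> accurate G y -> accurate (fun t => F t - G t) (x - y).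
Proof. by move=> FA /accurateN; apply: accurateD. Qed.

Lemma accurate_norm F x : accurate F x -> accurate (fun t => `|F t|) `|x|.
Proof.
move=> [C [u0 [C0 u00 H]]]; exists C, u0; split=> // t /H.
by apply: le_trans; apply: ler_dist_dist.
Qed.

(** An accurate approximation of a nonzero number is eventually bounded away
    from zero, which makes division harmless. *)
Lemma accurate_away F x : accurate F x -> x != 0 ->
  exists2 u0, 0 < u0 & forall t, 0 <= u t <= u0 -> `|x| / 2 <= `|F t|.
Proof.
move=> [C [u0 [C0 u00 H]]] x0; have nx : 0 < `|x| by rewrite normr_gt0.
have C1 : 0 < 2 * C + 1 by lra.
(* This keeps [C * u t] below half of [`|x|]. *)
exists (Num.min u0 (`|x| / (2 * C + 1))); first by rewrite lt_min u00 divr_gt0.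
move=> t; rewrite le_min => /and3P[ut t0]; rewrite ler_pdivlMr // => t1.
have {}H : `|F t - x| <= C * u t by apply: H; rewrite ut.
by have := ler_normD (x - F t) (F t); rewrite subrK distrC; lra.
Qed.

Lemma accurateV F x : accurate F x -> x != 0 ->
  accurate (fun t => (F t)^-1) x^-1.
Proof.
move=> FA x0; have [u1 u10 H1] := accurate_away FA x0.
have nx : 0 < `|x| by rewrite normr_gt0.
case: FA => C [u0 [C0 u00 H]].
exists (C * (2 / `|x|) / `|x|), (Num.min u0 u1); split.
- by rewrite !mulr_ge0 ?invr_ge0 ?divr_ge0.
- by rewrite lt_min u00.
move=> t; rewrite le_min => /and3P[ut t0 t1].
have {}H1 : `|x| / 2 <= `|F t| by rewrite H1 ?ut.
have Ft : 0 < `|F t| by apply: lt_le_trans H1; rewrite divr_gt0.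
have F0 : F t != 0 by rewrite -normr_gt0.
rewrite (_ : _ - _ = (x - F t) / F t / x); last by field; rewrite ?F0 ?x0.
rewrite !normrM !normrV ?unitfE // [leRHS]mulrAC ler_pM2r ?invr_gt0 //.
rewrite -[leRHS]mulrAC ler_pM ?invr_ge0 // ?(distrC x) ?H ?ut //.
by rewrite -[2 / _]invf_div lef_pV2 // posrE divr_gt0.
Qed.

Lemma accurate_sum (I : Type) (s : seq I) (P : pred I) (F : I -> T -> R) X :
    (forall i, P i -> accurate (F i) (X i)) ->
  accurate (fun t => \sum_(i <- s | P i) F i t) (\sum_(i <- s | P i) X i).
Proof.
move=> H; elim: s => [|i s IH].
  by apply: (accurate_eq _ _ (accurate_const 0)) => [t|]; rewrite big_nil.
case Pi: (P i).
  apply: (accurate_eq _ _ (accurateD (H i Pi) IH)) => [t|];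
    by rewrite big_cons Pi.
by apply: (accurate_eq _ _ IH) => [t|]; rewrite big_cons Pi.
Qed.

Lemma accurate_prod (I : Type) (s : seq I) (P : pred I) (F : I -> T -> R) X :
    (forall i, P i -> accurate (F i) (X i)) ->
  accurate (fun t => \prod_(i <- s | P i) F i t) (\prod_(i <- s | P i) X i).
Proof.
move=> H; elim: s => [|i s IH].
  by apply: (accurate_eq _ _ (accurate_const 1)) => [t|]; rewrite big_nil.
case Pi: (P i).
  apply: (accurate_eq _ _ (accurateM (H i Pi) IH)) => [t|];
    by rewrite big_cons Pi.
by apply: (accurate_eq _ _ IH) => [t|]; rewrite big_cons Pi.
Qed.

(** Finitely many accurate quantities share their constants. *)
Lemma accurate_uniform (I : finType) (F : I -> T -> R) X :
    (forall i, accurate (F i) (X i)) ->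
  exists C u0, [/\ 0 <= C, 0 < u0 &
    forall t, 0 <= u t <= u0 -> forall i, `|F i t - X i| <= C * u t].
Proof.
move=> H; suff [C [u0 [C0 u00 HC]]] : exists C u0, [/\ 0 <= C, 0 < u0 &
    forall t, 0 <= u t <= u0 ->
      forall i, i \in enum I -> `|F i t - X i| <= C * u t].
  by exists C, u0; split=> // t ut i; apply: HC; rewrite // mem_enum.
elim: (enum I) => [|i s [C [u0 [C0 u00 IH]]]]; first by exists 0, 1.
have [D [u1 [D0 u10 {}H]]] := H i.
exists (D + C), (Num.min u0 u1); split; rewrite ?addr_ge0 ?lt_min ?u00 //.
move=> t; rewrite le_min => /and3P[ut t0 t1] j; rewrite inE mulrDl.
case/orP=> [/eqP->|js].
  by apply: le_trans (H t _) _; rewrite ?ut // lerDl mulr_ge0.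
by apply: le_trans (IH t _ j js) _; rewrite ?ut // lerDr mulr_ge0.
Qed.

Lemma accurate_accum n v F G B x b : precision v ->
    (forall t, `|G t - F t| <= accum n (v t) * `|B t|) ->
  accurate F x -> accurate B b -> accurate G x.
Proof.
move=> vu H; apply: accurate_err; exists (2 * n%:R), (2 * n%:R + 1)^-1.
have n0 : 0 <= n%:R :> R by exact: ler0n.
split; rewrite ?invr_gt0; [by lra..|move=> t /andP[ut u1]].
apply: le_trans (H t) _; rewrite ler_wpM2r //; have /andP[v0 vt] := vu t.
have {}u1 : (2 * n%:R + 1) * u t <= 1.
  by rewrite -ler_pdivlMl ?mulr1 //; lra.
by apply: le_trans (accum_linear v0 _) _; nra.
Qed.

Lemma accurate_fl v F G x : precision v ->
  (forall t, fl (v t) (F t) (G t)) -> accurate F x -> accurate G x.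
Proof.
move=> vu H FA; apply: (accurate_accum (n := 1) (F := F) vu _ FA FA) => t.
by rewrite /accum expr1 addrAC subrr add0r; apply: fl_err.
Qed.

Lemma accurate_fl_theta n v F G x : precision v ->
  (forall t, fl_theta (v t) n (F t) (G t)) -> accurate F x -> accurate G x.
Proof.
move=> vu H FA; apply: (accurate_err _ FA FA).
exists (2 * n%:R), (2 * n%:R + 1)^-1.
have n0 : 0 <= n%:R :> R by exact: ler0n.
split; rewrite ?invr_gt0; [by lra..|move=> t /andP[ut u1]].
have [e en ->] := H t; have /andP[v0 vt] := vu t.
rewrite (_ : _ - _ = e * F t); last by ring.
rewrite normrM ler_wpM2r //; apply: le_trans en _.
have {}u1 : (2 * n%:R + 1) * u t <= 1.
  by rewrite -ler_pdivlMl ?mulr1 //; lra.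
by apply: le_trans (gamma_linear v0 _) _; nra.
Qed.

Lemma accurate_fl_sum (I : Type) (s : seq I) v (F : I -> T -> R) G X :
    precision v -> (forall t, fl_sum (v t) [seq F i t | i <- s] (G t)) ->
    (forall i, accurate (F i) (X i)) ->
  accurate G (\sum_(i <- s) X i).
Proof.
move=> vu H FA.
pose B t := \sum_(i <- s) `|F i t|.
have BA : accurate B (\sum_(i <- s) `|X i|).
  by apply: accurate_sum => i _; apply: accurate_norm.
apply: (accurate_accum (n := (size s).-1) vu _ _ BA); last first.
  by apply: accurate_sum => i _; apply: FA.
move=> t; have /andP[v0 _] := vu t; have := fl_sum_err v0 (H t).
by rewrite !big_map size_map (ger0_norm (sumr_ge0 _ _)).
Qed.

Lemma accurate_fl_prod (I : Type) (s : seq I) v (F : I -> T -> R) G X :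
    precision v -> (forall t, fl_prod (v t) [seq F i t | i <- s] (G t)) ->
    (forall i, accurate (F i) (X i)) ->
  accurate G (\prod_(i <- s) X i).
Proof.
move=> vu H FA; have PA := accurate_prod s (P := predT) (fun i _ => FA i).
apply: (accurate_accum (n := (size s).-1) vu _ PA PA) => t.
by have /andP[v0 _] := vu t; have := fl_prod_err v0 (H t); rewrite !big_map size_map.
Qed.

Lemma accurate_fl_dot (I : finType) (P : pred I) v (F H : I -> T -> R) G X Y :
    precision v ->
    (forall t, fl_dot (v t) P (fun i => F i t) (fun i => H i t) (G t)) ->
    (forall i, accurate (F i) (X i)) -> (forall i, accurate (H i) (Y i)) ->
  accurate G (\sum_(i | P i) X i * Y i).
Proof.
move=> vu fG FA HA.
pose B t := \sum_(i | P i) `|F i t * H i t|.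
have BA : accurate B (\sum_(i | P i) `|X i * Y i|).
  by apply: accurate_sum => i _; apply/accurate_norm/accurateM.
apply: (accurate_accum (n := #|P|) vu _ _ BA); last first.
  by apply: accurate_sum => i _; apply: accurateM.
move=> t; have /andP[v0 _] := vu t; have := fl_dot_err v0 (fG t).
by rewrite (ger0_norm (sumr_ge0 _ _)).
Qed.

End Accuracy.

Section Restriction.
Variables (R : realFieldType) (T : Type) (u : T -> R).
Implicit Types (F G : T -> R) (x y : R).

Lemma accurate_comp (S : Type) (g : S -> T) F x :
  accurate u F x -> accurate (u \o g) (F \o g) x.
Proof.
by move=> [C [u0 [C0 u00 H]]]; exists C, u0; split=> // t; apply: H.
Qed.

(** The control flow of an algorithm may depend on computed values, as long as
    it has finitely many branches: each one can then be studied on its own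
    runs. *)
Lemma accurate_split (I : finType) (g : T -> I) F x :
    (forall i, accurate (u \o sval) (F \o sval : {t | g t = i} -> R) x) ->
  accurate u F x.
Proof.
move=> H; suff [C [u0 [C0 u00 HC]]] : exists C u0, [/\ 0 <= C, 0 < u0 &
    forall t, 0 <= u t <= u0 -> g t \in enum I -> `|F t - x| <= C * u t].
  by exists C, u0; split=> // t ut; apply: HC; rewrite // mem_enum.
elim: (enum I) => [|i s [C [u0 [C0 u00 IH]]]]; first by exists 0, 1.
have [D [u1 [D0 u10 {}H]]] := H i.
exists (D + C), (Num.min u0 u1); split; rewrite ?addr_ge0 ?lt_min ?u00 //.
move=> t; rewrite le_min => /and3P[ut t0 t1]; rewrite inE mulrDl.
case/orP=> [/eqP gt|gs].
  by apply: le_trans (H (exist _ t gt) _) _; rewrite /= ?ut // lerDl mulr_ge0.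
by apply: le_trans (IH t _ gs) _; rewrite ?ut // lerDr mulr_ge0.
Qed.

(** Runs on which an approximation of a nonzero number vanishes have large [u]
    and can be ignored. *)
Lemma accurate_nonzero G y F x : accurate u G y -> y != 0 ->
    accurate (u \o sval) (F \o sval : {t | G t != 0} -> R) x ->
  accurate u F x.
Proof.
move=> GA y0 [C [u0 [C0 u00 H]]]; have [u1 u10 H1] := accurate_away GA y0.
exists C, (Num.min u0 u1); split; rewrite ?lt_min ?u00 // => t.
rewrite le_min => /and3P[ut t0 t1].
have G0 : G t != 0.
  rewrite -normr_gt0; apply: lt_le_trans (H1 t _); rewrite ?ut //.
  by rewrite divr_gt0 // normr_gt0.
by apply: (H (exist _ t G0)); rewrite /= ut.
Qed.

End Restriction.

(** * Determinants and inverses *)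

Section Determinant.
Variable R : realFieldType.

(** One step of block elimination; [N] is the product of a unit lower triangular
    and an upper triangular block matrix. *)
Lemma det_schur n (N : 'M[R]_n.+1) : N ord0 ord0 != 0 ->
  \det N = N ord0 ord0 * \det (\matrix_(k, j)
    (N (lift ord0 k) (lift ord0 j)
     - N (lift ord0 k) ord0 / N ord0 ord0 * N ord0 (lift ord0 j))).
Proof.
move=> N0; set S := (X in _ = _ * \det X).
pose l : 'cV[R]_n := \col_k (N (lift ord0 k) ord0 / N ord0 ord0).
pose r : 'rV[R]_n := \row_j N ord0 (lift ord0 j).
have NE : N = block_mx 1%:M 0 l 1%:M *m block_mx (N ord0 ord0)%:M r 0 S
    :> 'M_(1 + n).
  rewrite mulmx_block !mul1mx !mul0mx !addr0.
  rewrite -[LHS](@submxK _ 1 n 1 n); congr block_mx; apply/matrixP => i j.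
  - by rewrite !ord1 !mxE mulr1n !lshift0.
  - by rewrite !ord1 !mxE lshift0 rshift1.
  - rewrite !ord1 mul_mx_scalar !mxE lshift0 rshift1.
    by rewrite mulrC divfK.
  - by rewrite !mxE big_ord1 !mxE !rshift1; ring.
rewrite [LHS](congr1 (@determinant R (1 + n)) NE).
by rewrite det_mulmx det_lblock det_ublock !det1 !mul1r det_scalar1.
Qed.

Lemma det_xrow n (i j : 'I_n) (M : 'M[R]_n) :
  \det (xrow i j M) = (-1) ^+ (i != j) * \det M.
Proof. by rewrite xrowE det_mulmx det_perm odd_tperm. Qed.

Lemma fl_lu_size u n (M : 'M[R]_n) sg ds : fl_lu u M sg ds -> size ds = n.
Proof.
elim: n M sg ds => [|n IH] M sg ds /=; first by case=> _ ->.
by move=> [i [l [P [S [sg' [ds' [_ [_ [_ [_ [/IH szE [_ ->]]]]]]]]]]]]; rewrite /= szE.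
Qed.

End Determinant.

Section AccurateMatrices.
Variables (R : realFieldType).

(** If every run contradicts the sign of an exact quantity, then no run has a
    small [u], and any claim about small [u] is vacuous. *)
Lemma accurate_absurd T (u : T -> R) F x G y : accurate u F x -> 0 < x ->
  (forall t, F t <= 0) -> accurate u G y.
Proof.
move=> [C [u0 [C0 u00 H]]] x0 F0; have C1 : 0 < C + 1 by lra.
exists 0, (Num.min u0 (x / (C + 1) / 2)).
split; rewrite ?lt_min ?u00 ?divr_gt0 // => t.
rewrite le_min => /and3P[ut t0]; rewrite ler_pdivlMr // ler_pdivlMr // => t1.
have /ler_normlP[] : `|F t - x| <= C * u t by apply: H; rewrite ut.
by have := F0 t; lra.
Qed.

Variables (T : Type) (u : T -> R).

Definition accurate_mx m n (A : T -> 'M[R]_(m, n)) (M : 'M[R]_(m, n)) : Prop :=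
  forall i j, accurate u (fun t => A t i j) (M i j).

Lemma accurate_det n (A : T -> 'M[R]_n) M :
  accurate_mx A M -> accurate u (fun t => \det (A t)) (\det M).
Proof.
move=> AM; apply: accurate_sum => s _; apply: accurateM.
  exact: accurate_const.
by apply: accurate_prod => i _; apply: AM.
Qed.

Lemma accurate_invmx n (A : T -> 'M[R]_n) M :
    accurate_mx A M -> \det M != 0 -> (forall t, \det (A t) != 0) ->
  accurate_mx (fun t => invmx (A t)) (invmx M).
Proof.
move=> AM M0 A0 i j; pose cof (N : 'M[R]_n) := cofactor N j i.
apply: (@accurate_eq _ _ _ (fun t => (\det (A t))^-1 * cof (A t)) _
          ((\det M)^-1 * cof M)).
- by move=> t; rewrite /invmx unitmxE unitfE A0 !mxE.
- by rewrite /invmx unitmxE unitfE M0 !mxE.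
apply: accurateM; first exact: accurateV (accurate_det AM) M0.
apply: accurateM; first exact: accurate_const.
apply: accurate_det => k l.
by apply: (accurate_eq _ _ (AM (lift j k) (lift i l))) => [t|]; rewrite !mxE.
Qed.

Lemma accurate_mulmx m n p (A : T -> 'M[R]_(m, n)) M
    (B : T -> 'M[R]_(n, p)) N :
  accurate_mx A M -> accurate_mx B N ->
  accurate_mx (fun t => A t *m B t) (M *m N).
Proof.
move=> AM BN i j.
apply: (@accurate_eq _ _ _ (fun t => \sum_k A t i k * B t k j) _
          (\sum_k M i k * N k j)) => [t||]; rewrite ?mxE //.
by apply: accurate_sum => k _; apply: accurateM.
Qed.

Lemma accurate_absmx m n (A : T -> 'M[R]_(m, n)) M :
  accurate_mx A M -> accurate_mx (fun t => absmx (A t)) (absmx M).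
Proof.
move=> AM i j.
by apply: (accurate_eq _ _ (accurate_norm (AM i j))) => [t|]; rewrite mxE.
Qed.

End AccurateMatrices.

Section LU.
Variable R : realFieldType.

(** By induction on the size, splitting by the row [i] selected as first pivot.
    Some entry of the first column of [M] is nonzero, so if [M i 0 = 0] then the
    pivoting rule fails for small [u]. Otherwise the computed Schur complement
    approximates the exact one for the pivot row [i], which is nonsingular since
    its determinant is a factor of [det M]. *)
Lemma accurate_lu n (T : Type) (u v : T -> R) (A : T -> 'M[R]_n) M sg ds :
    precision u v -> accurate_mx u A M -> \det M != 0 ->
    (forall t, fl_lu (v t) (A t) (sg t) (ds t)) ->
  accurate u (fun t => (-1) ^+ sg t * \prod_(x <- ds t) x) (\det M).
Proof.
elim: n T u v A M sg ds => [|n IH] T u v A M sg ds vu AM M0 /=.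
  move=> H; apply: (accurate_eq _ _ (accurate_const u 1)) => [t|].
    by have [-> ->] := H t; rewrite big_nil mulr1.
  by rewrite det_mx00.
case/functional_choice=> piv /functional_choice[l /functional_choice[P]].
case/functional_choice=> S /functional_choice[sg' /functional_choice[ds' H]].
apply: (accurate_split (g := piv)) => i.
pose Ti := {t | piv t = i}; pose ui : Ti -> R := u \o sval.
have Ai : accurate_mx ui (fun t => A (sval t)) M.
  by move=> k j; apply: accurate_comp (AM k j).
have [Mi0|Mi0] := eqVneq (M i ord0) 0.
  have [k Mk0] : exists k, M k ord0 != 0.
    apply/existsP; apply: contraNT M0 => /existsPn Z.
    rewrite (expand_det_col _ ord0) big1 // => k _.
    by rewrite (eqP (negbNE (Z k))) mul0r.
  have dA := accurateB (accurate_norm (Ai k ord0)) (accurate_norm (Ai i ord0)).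
  apply: (accurate_absurd _ _ dA).
    by rewrite Mi0 normr0 subr0 normr_gt0.
  case=> t ti; rewrite subr_le0 /= -ti.
  by case: (H t) => /(_ k).
pose N (t : Ti) := xrow (piv (sval t)) ord0 (A (sval t)).
pose N0 := xrow i ord0 M.
have NA : accurate_mx ui N N0.
  move=> k j; apply: (accurate_eq _ _ (Ai (tperm i ord0 k) j)) => [[t ti]|].
    by rewrite /N !mxE /= ti.
  by rewrite !mxE.
have N00 : N0 ord0 ord0 != 0 by rewrite mxE tpermR.
have vui : precision ui (v \o sval) by move=> t; apply: vu.
set S0 := \matrix_(k, j) (N0 (lift ord0 k) (lift ord0 j)
  - N0 (lift ord0 k) ord0 / N0 ord0 ord0 * N0 ord0 (lift ord0 j)).
have detM : \det M = (-1) ^+ (i != ord0) * (N0 ord0 ord0 * \det S0).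
  by rewrite -det_schur // det_xrow signrMK.
have S00 : \det S0 != 0.
  by apply: contraNneq M0 => S00; rewrite detM S00 !mulr0.
have SA : accurate_mx ui (fun t => S (sval t)) S0.
  move=> k j; rewrite mxE.
  apply: (accurate_fl (v := v \o sval) vui) => [t|].
    by case: (H (sval t)) => _ [_ [_ [HS _]]]; apply: HS.
  apply: accurateB; first exact: NA.
  apply: (accurate_fl (v := v \o sval) vui) => [t|].
    by case: (H (sval t)) => _ [_ [HP _]]; apply: HP.
  apply: accurateM; last exact: NA.
  apply: (accurate_fl (v := v \o sval) vui) => [t|].
    by case: (H (sval t)) => _ [Hl _]; apply: Hl.
  by apply: accurateM; [exact: NA | exact: accurateV].
have LU (t : Ti) : fl_lu (v (sval t)) (S (sval t)) (sg' (sval t)) (ds' (sval t)).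
  by case: (H (sval t)) => _ [_ [_ [_ []]]].
have {IH} := IH _ _ _ _ _ _ _ vui SA S00 LU.
move/(accurateM (NA ord0 ord0))/(accurateM (accurate_const ui ((-1) ^+ (i != ord0)))).
apply: accurate_eq => // -[t ti] /=.
have [_ [_ [_ [_ [_ [-> ->]]]]]] := H t.
by rewrite big_cons signr_addb /N /= ti; ring.
Qed.

Lemma accurate_fl_det n (T : Type) (u v : T -> R) (A : T -> 'M[R]_n) M y :
    precision u v -> accurate_mx u A M -> \det M != 0 ->
    (forall t, fl_det (v t) (A t) (y t)) ->
  accurate u y (\det M).
Proof.
move=> vu AM M0 /functional_choice[sg /functional_choice[ds]].
case/functional_choice=> x H.
have LU t : fl_lu (v t) (A t) (sg t) (ds t) by case: (H t).
have LA := accurate_lu vu AM M0 LU.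
apply: (accurate_accum (n := n.-1) vu _ LA LA) => t.
have /andP[v0 _] := vu t; case: (H t) => /fl_lu_size <- /(fl_prod_err v0).
by move=> E ->; rewrite -mulrBr !normrMsign.
Qed.

(** For small [u] the computed matrix is nonsingular, so the hypothesis on the
    algorithm applies; its right-hand side is [u] times an entry of a matrix
    that is itself accurate, hence bounded. *)
Lemma accurate_fl_inv n cinv (T : Type) (u v : T -> R) (A B : T -> 'M[R]_n) M :
    precision u v -> accurate_mx u A M -> \det M != 0 ->
    (forall t, fl_inv cinv (v t) (A t) (B t)) ->
  accurate_mx u B (invmx M).
Proof.
move=> vu AM M0 H i j.
apply: (accurate_nonzero (accurate_det AM) M0).
pose ui : {t | \det (A t) != 0} -> R := u \o sval.
have Ai : accurate_mx ui (fun t : {t | \det (A t) != 0} => A (sval t)) M.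
  by move=> k l; apply: accurate_comp (AM k l).
have Vi := accurate_invmx Ai M0 (fun t => svalP t).
have Wi := accurate_absmx Vi.
have := accurate_mulmx (accurate_mulmx Wi (accurate_absmx Ai)) Wi.
move=> /(_ i j); apply: accurate_err (Vi i j); exists `|cinv n|, 1.
split=> // -[t t0] /= _; have /andP[v0 vt] := vu t.
apply: le_trans (H t _ i j) _; first by rewrite unitmxE unitfE.
apply: le_trans (ler_norm _) _; rewrite normrM ler_wpM2r //.
by rewrite normrM ler_wpM2l // ger0_norm.
Qed.

End LU.

(** * Finite element computations *)

(** Choice turns the intermediate values, which the model only asserts to exist
    in each run, into functions on the runs. *)
Lemma functional_choice2 (S T : Type) (P Q : S -> T -> Prop) :
    (forall x, exists2 y, P x y & Q x y) ->
  exists2 g, (forall x, P x (g x)) & (forall x, Q x (g x)).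
Proof.
move=> H; have [x|g Hg] := functional_choice (fun x y => P x y /\ Q x y).
  by have [y Py Qy] := H x; exists y.
by exists g => x; case: (Hg x).
Qed.

(** The exact counterpart of the sum of products by which derivatives of basis
    functions are evaluated. *)
Lemma mderiv_prod (R : realFieldType) d (I : eqType) (s : seq I)
    (F : I -> {mpoly R[d]}) (i : 'I_d) : uniq s ->
  (\prod_(j <- s) F j)^`M(i) =
    \sum_(j <- s) (F j)^`M(i) * \prod_(l <- s | l != j) F l.
Proof.
elim: s => [|j s IH] /=; first by rewrite !big_nil -[1]/(1%:MP) mderivC.
case/andP=> js us; rewrite !big_cons mderivM IH // eqxx; congr (_ * _ + _).
  rewrite big_seq_cond [RHS]big_seq_cond; apply: eq_bigl => l.
  by case: (boolP (l \in s)) => //= ls; apply/esym; apply: contraNneq js => <-.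
rewrite mulr_sumr [LHS]big_seq [RHS]big_seq; apply: eq_bigr => l ls.
rewrite big_cons ifT; first by rewrite mulrCA.
by apply: contraNneq js => ->.
Qed.

Section AccurateFiniteElement.
Variables (R : realFieldType) (sh : cell_shape) (d p nq : nat).
Variables (r : nat) (cinv : nat -> R).
Variables (T : Type) (u : T -> R).
Implicit Types (x : 'I_d -> R) (y : T -> R).

Lemma accurate_fl_prod_seq v (fs : seq (T -> R)) (xs : seq R) y :
    precision u v -> size fs = size xs ->
    (forall t, fl_prod (v t) [seq f t | f <- fs] (y t)) ->
    (forall i, accurate u (nth (fun=> 0) fs i) (nth 0 xs i)) ->
  accurate u y (\prod_(z <- xs) z).
Proof.
move=> vu szE fy H.
rewrite (big_nth 0) /index_iota subn0 -szE.
apply: (accurate_fl_prod (F := nth (fun=> 0) fs) (X := nth 0 xs) vu) => // t.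
by have := fy t; rewrite -{1}[fs](mkseq_nth (fun=> 0)) /mkseq -map_comp.
Qed.

Section Basis.
Variables (q : nat) (F : lagrange_basis R sh d q) (v : T -> R).
Hypothesis vu : precision u v.
Implicit Type k : 'I_(space_dim sh d q).

Lemma lag_eval k x :
  (lag F k).@[x] = lag_const F k * \prod_l (lag_factor F k l).@[x].
Proof. by rewrite mevalZ rmorph_prod. Qed.

Lemma dlag_eval k s x : (lag F k)^`M(s).@[x] = lag_const F k *
  \sum_j (lag_factor F k j)^`M(s).@[x] *
    \prod_(l | l != j) (lag_factor F k l).@[x].
Proof.
rewrite mderivZ mevalZ mderiv_prod ?index_enum_uniq // rmorph_sum /=.
by congr (_ * _); apply: eq_bigr => j _; rewrite mevalM rmorph_prod.
Qed.

Lemma accurate_fl_lag k x y :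
    (forall t, fl_lag F r (v t) k x (y t)) ->
  accurate u y (lag F k).@[x].
Proof.
case/functional_choice=> w /functional_choice[l H]; rewrite lag_eval.
(* [None] is the index of the constant factor. *)
pose f o t := if o is Some i then l t i else w t.
pose X o := if o is Some i then (lag_factor F k i).@[x] else lag_const F k.
have := accurate_fl_prod (F := f) (G := y) (X := X) vu
  (s := None :: map Some (enum 'I_(nfactors sh d q))).
rewrite big_cons big_map big_enum; apply=> [t|[i|]].
- by case: (H t) => _ _; rewrite /= -map_comp.
- apply: (accurate_fl_theta (v := v) vu _ (accurate_const u _)) => t.
  by case: (H t) => _ Hl _; apply: Hl.
- apply: (accurate_fl (v := v) vu _ (accurate_const u _)) => t.
  by case: (H t).
Qed.

Lemma accurate_fl_dlag k s x y :
    (forall t, fl_dlag F r (v t) k s x (y t)) ->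
  accurate u y ((lag F k)^`M(s)).@[x].
Proof.
case/functional_choice=> w /functional_choice[a /functional_choice[l]].
case/functional_choice=> dl /functional_choice[b H]; rewrite dlag_eval.
apply: (accurate_fl (v := v) (F := fun t => w t * a t) vu) => [t|].
  by case: (H t) => _ [_ [_ [_ []]]].
apply: accurateM.
  apply: (accurate_fl (v := v) vu _ (accurate_const u _)) => t.
  by case: (H t).
rewrite -big_enum.
apply: (accurate_fl_sum (F := fun j t => b t j) (v := v) vu) => [t|j].
  by case: (H t) => _ [_ [_ [_ []]]].
(* [None] is the index of the factor that is differentiated. *)
pose f o t := if o is Some i then l t i else dl t j.
pose X o := if o is Some i then (lag_factor F k i).@[x]
            else ((lag_factor F k j)^`M(s)).@[x].
have := accurate_fl_prod (F := f) (G := fun t => b t j) (X := X) vu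
  (s := None :: map Some (enum (predC1 j))).
rewrite big_cons big_map big_enum; apply=> [t|[i|]].
- by case: (H t) => _ [_ [_ [/(_ j) Hb _]]]; move: Hb; rewrite /= -map_comp.
- apply: (accurate_fl_theta (v := v) vu _ (accurate_const u _)) => t.
  by case: (H t) => _ [Hl _]; apply: Hl.
- apply: (accurate_fl (v := v) vu _ (accurate_const u _)) => t.
  by case: (H t) => _ [_ [Hd _]]; apply: Hd.
Qed.

Lemma accurate_fl_component f k (s : 'I_(form_dim f d)) x y :
    (forall t, fl_component F r (v t) k s x (y t)) ->
  accurate u y (component (lag F k) s).@[x].
Proof. by case: f s => s; [apply: accurate_fl_lag | apply: accurate_fl_dlag]. Qed.

End Basis.

Variables (f : weak_form) (E : reference R sh d p nq) (K : cell R sh d p).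
Variables (vp vg vq vs : T -> R).
Hypotheses (vpu : precision u vp) (vgu : precision u vg).
Hypotheses (vqu : precision u vq) (vsu : precision u vs).
Hypothesis K_nondegenerate : nondegenerate_cell E K.
Notation nphi := (space_dim sh d p).
Notation nd := (form_dim f d).

Lemma accurate_fl_jacobian x (J : T -> 'M[R]_d) :
    (forall t, fl_jacobian E K r (vg t) x (J t)) ->
  accurate_mx u J (jacobian E K x).
Proof.
case/functional_choice=> X /functional_choice[D H] i j; rewrite mxE.
apply: (accurate_fl_dot (v := vg) (F := fun k t => X t i k)
  (H := fun k t => D t k j) vgu) => [t|k|k].
- by case: (H t) => _ _ /(_ i j).
- apply: (accurate_fl (v := vg) vgu _ (accurate_const u _)) => t.
  by case: (H t) => /(_ i k).
- apply: (accurate_fl_dlag vgu) => t; by case: (H t) => _ /(_ k j).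
Qed.

Lemma accurate_fl_geometry x (G : T -> 'M[R]_nd) : ref_cell sh x ->
    (forall t, fl_geometry E K r cinv (vg t) x (G t)) ->
  accurate_mx u G (geometry f E K x).
Proof.
move=> /K_nondegenerate J0 /functional_choice[J /functional_choice[dJ H]].
have JA : accurate_mx u J (jacobian E K x).
  by apply: accurate_fl_jacobian => t; case: (H t).
have dA : accurate u dJ (\det (jacobian E K x)).
  by apply: (accurate_fl_det vgu JA J0) => t; case: (H t).
have {dA} := accurate_norm dA.
case: f G H => /= G H dA s t.
  apply: (accurate_eq _ _ dA) => [w|].
    by case: (H w) => _ _ ->; rewrite !ord1 mxE.
  by rewrite !ord1 mxE.
have {}H w := let: And3 _ _ h := H w in h.
case/functional_choice: H => Ji /functional_choice[S H].
have VA : accurate_mx u Ji (invmx (jacobian E K x)).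
  by apply: (accurate_fl_inv vgu JA J0 (cinv := cinv)) => w; case: (H w).
rewrite mxE.
apply: (accurate_fl (v := vg) (F := fun w => `|dJ w| * S w s t) vgu) => [w|].
  by case: (H w) => _ _ /(_ s t).
apply: accurateM => //.
have := accurate_fl_dot (F := fun k w => Ji w s k) (H := fun k w => Ji w t k)
  (G := fun w => S w s t) (P := predT) vgu _ (VA s) (VA t).
have -> : (invmx (jacobian E K x) *m (invmx (jacobian E K x))^T) s t =
    \sum_k invmx (jacobian E K x) s k * invmx (jacobian E K x) t k.
  by rewrite mxE; apply: eq_bigr => k _; rewrite !mxE.
by apply=> w; case: (H w) => _ /(_ s t).
Qed.

Lemma fe_fun_eval c x : (fe_fun E c).@[x] = \sum_k c k * (lag (fe_basis E) k).@[x].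
Proof. by rewrite raddf_sum; apply: eq_bigr => k _ /=; rewrite mevalZ. Qed.

Lemma fe_deriv_eval c s x :
  ((fe_fun E c)^`M(s)).@[x] = \sum_k c k * ((lag (fe_basis E) k)^`M(s)).@[x].
Proof.
rewrite /fe_fun (raddf_sum (mderiv s)) raddf_sum.
by apply: eq_bigr => k _ /=; rewrite mderivZ mevalZ.
Qed.

Lemma accurate_fl_fe_value c x y :
    (forall t, fl_fe_value E r (vp t) (vg t) c x (y t)) ->
  accurate u y (fe_fun E c).@[x].
Proof.
case/functional_choice=> b /functional_choice[a H]; rewrite fe_fun_eval.
apply: (accurate_fl (v := vg) (F := a) vgu) => [t|]; first by case: (H t).
apply: (accurate_fl_dot (v := vp) (F := fun k _ => c k)
  (H := fun k t => b t k) vpu) => [t|k|k].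
- by case: (H t).
- exact: accurate_const.
- by apply: (accurate_fl_lag vpu) => t; case: (H t).
Qed.

Lemma accurate_fl_fe_deriv c s x y :
    (forall t, fl_fe_deriv E r (vp t) (vg t) c s x (y t)) ->
  accurate u y ((fe_fun E c)^`M(s)).@[x].
Proof.
case/functional_choice=> b /functional_choice[a H]; rewrite fe_deriv_eval.
apply: (accurate_fl (v := vg) (F := a) vgu) => [t|]; first by case: (H t).
apply: (accurate_fl_dot (v := vp) (F := fun k _ => c k)
  (H := fun k t => b t k) vpu) => [t|k|k].
- by case: (H t).
- exact: accurate_const.
- by apply: (accurate_fl_dlag vpu) => t; case: (H t).
Qed.

Lemma accurate_fl_Bmx (s : 'I_nd) (B : T -> 'M[R]_(nphi, nq)) :
    (forall t, fl_Bmx E r (vp t) (vs t) s (B t)) ->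
  accurate_mx u B (Bmx E s).
Proof.
move=> H k q; rewrite mxE.
have {H} [b Hb HB] := functional_choice2 (fun t => H t k q).
apply: (accurate_fl (v := vs) (F := b) vsu) => //.
exact: (accurate_fl_component vpu).
Qed.

Lemma accurate_fl_Cdiag (s t : 'I_nd) (C : T -> 'I_nq -> R) q :
    (forall w, fl_Cdiag E K r cinv (vp w) (vg w) (vs w) s t (C w)) ->
  accurate u (fun w => C w q) (Cmx E K s t q q).
Proof.
move=> H; have {}H c := H c q.
case/functional_choice: H => w.
case/functional_choice=> z /functional_choice[a /functional_choice[G H]].
rewrite !mxE eqxx mulr1n; apply: (accurate_fl (v := vs) (F := a) vsu) => [c|].
  by case: (H c) => _ [_ [_ []]].
have := @accurate_fl_prod_seq vg [:: w; fun c => G c s t; z]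
  [:: qweight E q; geometry f E K (qpoint E q) s t;
      (fe_fun E (zcoef K)).@[qpoint E q]] a vgu erefl.
rewrite !big_cons big_nil mulr1 mulrA; apply=> [c|].
  by case: (H c) => _ [_ [_ []]].
case=> [|[|[|i]]] /=; last by rewrite !nth_nil; apply: accurate_const.
- apply: (accurate_fl (v := vg) vgu _ (accurate_const u _)) => c.
  by case: (H c).
- refine (accurate_fl_geometry (qpoint_cell E q) _ s t) => c.
  by case: (H c) => _ [].
- by apply: accurate_fl_fe_value => c; case: (H c) => _ [_ []].
Qed.

Lemma accurate_fl_rvec (s : 'I_nd) (rv : T -> 'cV[R]_nq) :
    (forall t, fl_rvec E K r cinv (vp t) (vg t) (vs t) s (rv t)) ->
  accurate_mx u rv (rvec E K s).
Proof.
move=> H q j; rewrite ord1 mxE {j}.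
have {}H c := H c q.
case/functional_choice: H => w.
case/functional_choice=> z /functional_choice[a /functional_choice[G H]].
apply: (accurate_fl (v := vs) (F := a) vsu) => [c|].
  by case: (H c) => _ [_ [_ []]].
have wA : accurate u w (qweight E q).
  apply: (accurate_fl (v := vg) vgu _ (accurate_const u _)) => c.
  by case: (H c).
have GA : accurate_mx u G (geometry f E K (qpoint E q)).
  apply: accurate_fl_geometry (qpoint_cell E q) _ => c.
  by case: (H c) => _ [].
have zA : accurate u z (fe_fun E (zcoef K)).@[qpoint E q].
  by apply: accurate_fl_fe_value => c; case: (H c) => _ [_ []].
have {}H c := let: conj _ (conj _ (conj _ (conj h _))) := H c in h.
case: f s G GA H => /= s G GA H.
  have {H} [v Hv Ha] := functional_choice2 H.
  have := @accurate_fl_prod_seq vg [:: w; z; fun c => G c s s; v]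
    [:: qweight E q; (fe_fun E (zcoef K)).@[qpoint E q];
        geometry Mass E K (qpoint E q) s s;
        (fe_fun E (wcoef K)).@[qpoint E q]] a vgu erefl Ha.
  rewrite !big_cons big_nil mulr1 big_ord1 !ord1 mulrA; apply.
  case=> [|[|[|[|i]]]] //=; last by rewrite !nth_nil; apply: accurate_const.
  exact: accurate_fl_fe_value.
case/functional_choice: H => dv /functional_choice[g H].
have := @accurate_fl_prod_seq vg [:: w; z; g]
  [:: qweight E q; (fe_fun E (zcoef K)).@[qpoint E q];
      \sum_t geometry Poisson E K (qpoint E q) s t *
        ((fe_fun E (wcoef K))^`M(t)).@[qpoint E q]] a vgu erefl.
rewrite !big_cons big_nil mulr1 mulrA; apply=> [c|]; first by case: (H c).
case=> [|[|[|i]]] //=; last by rewrite !nth_nil; apply: accurate_const.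
apply: (accurate_fl_dot (v := vg) (F := fun t c => G c s t)
  (H := fun t c => dv c t) vgu) => [c|t|t].
- by case: (H c).
- exact: GA.
- by apply: accurate_fl_fe_deriv => c; case: (H c) => /(_ t).
Qed.

Lemma accurate_fl_local_matrix (A : T -> 'M[R]_nphi) :
    (forall t, fl_local_matrix f E K r cinv (vp t) (vg t) (vq t) (vs t) (A t)) ->
  accurate_mx u A (local_matrix f E K).
Proof.
case/functional_choice=> B /functional_choice[C /functional_choice[H HA]] i j.
have BA s : accurate_mx u (fun t => B t s) (Bmx E s).
  by apply: accurate_fl_Bmx => t; case: (HA t).
have HH s t q k : accurate u (fun w => H w s t q k) (Hmx E K s t q k).
  rewrite /Hmx mul_diag_mx !mxE.
  apply: (accurate_fl (v := vs) (F := fun w => C w s t q * B w t k q) vsu) => [w|].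
    by case: (HA w).
  apply: accurateM; last by have := BA t k q; rewrite mxE.
  have := @accurate_fl_Cdiag s t (fun w => C w s t) q.
  by rewrite !mxE eqxx mulr1n; apply=> w; case: (HA w).
have -> : local_matrix f E K i j = \sum_(a : 'I_nd * 'I_nd * 'I_nq)
    Bmx E a.1.1 i a.2 * Hmx E K a.1.1 a.1.2 a.2 j.
  rewrite /local_matrix pair_bigA summxE.
  rewrite -(pair_bigA _ (fun b q => Bmx E b.1 i q * Hmx E K b.1 b.2 q j)).
  by apply: eq_bigr => b _; rewrite mxE.
apply: (accurate_fl_dot (v := vq)
  (F := fun (a : 'I_nd * 'I_nd * 'I_nq) w => B w a.1.1 i a.2)
  (H := fun (a : 'I_nd * 'I_nd * 'I_nq) w => H w a.1.1 a.1.2 a.2 j)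
  vqu) => [w|a|a].
- by case: (HA w).
- exact: BA.
- exact: HH.
Qed.

Lemma accurate_fl_local_vector (g : T -> 'cV[R]_nphi) :
    (forall t, fl_local_vector f E K r cinv (vp t) (vg t) (vq t) (vs t) (g t)) ->
  accurate_mx u g (local_vector f E K).
Proof.
case/functional_choice=> B /functional_choice[rv H] i j; rewrite ord1 {j}.
have -> : local_vector f E K i 0 =
    \sum_(a : 'I_nd * 'I_nq) Bmx E a.1 i a.2 * rvec E K a.1 a.2 0.
  rewrite summxE -(pair_bigA _ (fun s q => Bmx E s i q * rvec E K s q 0)).
  by apply: eq_bigr => s _; rewrite mxE.
apply: (accurate_fl_dot (v := vq) (F := fun a t => B t a.1 i a.2)
  (H := fun a t => rv t a.1 a.2 0) vqu) => [t|a|a].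
- by case: (H t).
- by apply: accurate_fl_Bmx => t; case: (H t).
- by apply: accurate_fl_rvec => t; case: (H t).
Qed.

End AccurateFiniteElement.

(** * Assembly *)

Section Assembly.
Variables (R : realFieldType) (u : R) (m n N : nat) (L : 'M[R]_(m, n)).
Hypotheses (u_ge0 : 0 <= u) (Nu : N%:R * u < 1).
Hypothesis L_bool : boolean_assembly L.
Hypothesis L_row : forall i, (#|[set j | L i j != 0%R]| <= N)%N.
Notation g := (gamma N u).

Lemma gamma_ge0 : 0 <= g.
Proof. by rewrite divr_ge0 ?mulr_ge0 // subr_ge0 ltW. Qed.

Lemma assembly_ge0 i j : 0 <= L i j.
Proof. by case: L_bool => /(_ i j) [] ->. Qed.

Lemma assembly_le q (A B : 'M[R]_(n, q)) i j :
  (forall k, A k j <= B k j) -> (L *m A) i j <= (L *m B) i j.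
Proof.
by move=> AB; rewrite !mxE; apply: ler_sum => k _; rewrite ler_wpM2l ?assembly_ge0.
Qed.

Lemma assembly_norm q (A : 'M[R]_(n, q)) i j :
  `|(L *m A) i j| <= (L *m absmx A) i j.
Proof.
rewrite !mxE; apply: le_trans (ler_norm_sum _ _ _) _; apply: ler_sum => k _.
by rewrite mxE normrM (ger0_norm (assembly_ge0 _ _)).
Qed.

(** The terms off the support of a row contribute nothing, so the reduction has
    at most [N] terms; nonnegativity of [L] moves the absolute values inside. *)
Lemma fl_boolmul_err q (M : 'M[R]_(n, q)) P i j : fl_boolmul u L M P ->
  `|P i j - (L *m M) i j| <= g * (L *m absmx M) i j.
Proof.
move=> /(_ i j) /(fl_dot_err u_ge0); rewrite !mxE.
have supp (F : 'I_n -> R) : (forall k, L i k = 0 -> F k = 0) ->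
    \sum_(k | [pred k | L i k != 0] k) F k = \sum_k F k.
  move=> F0; rewrite [RHS](bigID [pred k | L i k != 0]) /= [X in _ + X]big1 ?addr0 //.
  by move=> k /negPn/eqP /F0.
rewrite !supp; try by move=> k ->; rewrite ?mul0r ?normr0.
move=> /le_trans; apply.
rewrite (eq_bigr (fun k => L i k * absmx M k j)) => [|k _]; last first.
  by rewrite mxE normrM (ger0_norm (assembly_ge0 _ _)).
rewrite ler_wpM2r //.
  by apply: sumr_ge0 => k _; rewrite mxE mulr_ge0 ?assembly_ge0.
apply: le_trans (accum_gamma u_ge0 Nu); apply: le_accum => //.
by have := L_row i; rewrite cardsE.
Qed.

(** The second product amplifies the first error by [1 + g] and adds its own:
    [g (1 + g) + g = 2 g + g^2]. *)
Lemma fl_boolmul2_err (M : 'M[R]_n) P A i j :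
    fl_boolmul u L M P -> fl_boolmul u L P^T A ->
  `|A i j - (L *m (L *m M)^T) i j| <=
    (2 * g + g ^+ 2) * (L *m (L *m absmx M)^T) i j.
Proof.
move=> LM LP; set S := (L *m (L *m absmx M)^T) i j.
have E1 := fl_boolmul_err i j LP.
have E2 : `|(L *m P^T) i j - (L *m (L *m M)^T) i j| <= g * S.
  have -> : (L *m P^T) i j - (L *m (L *m M)^T) i j
      = (L *m (P - L *m M)^T) i j.
    by rewrite linearB mulmxBr !mxE.
  apply: le_trans (assembly_norm _ _ _) _.
  have -> : g * S = (L *m (g *: (L *m absmx M)^T)) i j.
    by rewrite -scalemxAr [RHS]mxE.
  apply: assembly_le => k; have := fl_boolmul_err j k LM; by rewrite !mxE.
have E3 : (L *m absmx P^T) i j <= (1 + g) * S.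
  have -> : (1 + g) * S = (L *m ((1 + g) *: (L *m absmx M)^T)) i j.
    by rewrite -scalemxAr [RHS]mxE.
  apply: assembly_le => k; have := fl_boolmul_err j k LM.
  have := assembly_norm M j k; rewrite !mxE => M1 M2.
  rewrite -[P j k](subrK ((L *m M) j k)); apply: le_trans (ler_normD _ _) _.
  by rewrite !mxE; lra.
rewrite -[A i j](subrK ((L *m P^T) i j)) -addrA.
apply: le_trans (ler_normD _ _) _.
have := ler_wpM2l gamma_ge0 E3; lra.
Qed.

(** Both orders of evaluation are the double product of [fl_boolmul2_err], for
    [M] or, after transposing the result, for its transpose. *)
Lemma fl_assemble_err (M : 'M[R]_n) A i j : fl_assemble u L M A ->
  `|A i j - (L *m M *m L^T) i j| <=
    (2 * g + g ^+ 2) * (L *m absmx M *m L^T) i j.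
Proof.
have trE (B : 'M[R]_n) : L *m (L *m B)^T = L *m B^T *m L^T.
  by rewrite trmx_mul mulmxA.
have trA (B : 'M[R]_n) : absmx B^T = (absmx B)^T.
  by apply/matrixP => k l; rewrite !mxE.
case=> -[P LM LP].
  have trC (B : 'M[R]_n) : (L *m B^T *m L^T) j i = (L *m B *m L^T) i j.
    transitivity ((L *m B *m L^T)^T j i); last by rewrite [LHS]mxE.
    by rewrite !trmx_mul trmxK mulmxA.
  by have := fl_boolmul2_err j i LM LP; rewrite !trE !trC [A^T j i]mxE.
have := fl_boolmul2_err i j LM LP.
by rewrite trA !trE !trmxK.
Qed.

Lemma assemble_ge0 (M : 'M[R]_n) i j : (forall k l, 0 <= M k l) ->
  0 <= (L *m M *m L^T) i j.
Proof.
move=> M0; rewrite mxE sumr_ge0 // => k _; rewrite !mxE mulr_ge0 ?assembly_ge0 //.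
by rewrite sumr_ge0 // => l _; rewrite mulr_ge0 ?assembly_ge0.
Qed.

Lemma assemble_le (A B : 'M[R]_n) i j : (forall k l, A k l <= B k l) ->
  (L *m A *m L^T) i j <= (L *m B *m L^T) i j.
Proof.
move=> AB; rewrite -subr_ge0.
have -> : (L *m B *m L^T) i j - (L *m A *m L^T) i j =
    (L *m (B - A) *m L^T) i j by rewrite mulmxBr mulmxBl !mxE.
by apply: assemble_ge0 => k l; rewrite !mxE subr_ge0.
Qed.

Lemma assemble_norm (M : 'M[R]_n) i j :
  `|(L *m M *m L^T) i j| <= (L *m absmx M *m L^T) i j.
Proof.
rewrite mxE [leRHS]mxE; apply: le_trans (ler_norm_sum _ _ _) _.
apply: ler_sum => k _; rewrite normrM [L^T k j]mxE.
by rewrite (ger0_norm (assembly_ge0 _ _)) ler_wpM2r ?assembly_ge0 ?assembly_norm.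
Qed.

End Assembly.

Section Blocks.
Variable R : realFieldType.

Lemma mxdiag_bound (n : nat) (q : 'I_n -> nat) (A B : forall k, 'M[R]_(q k)) e :
    0 <= e :> R -> (forall k i j, `|A k i j - B k i j| <= e) ->
  forall i j, absmx (mxdiag A - mxdiag B) i j <= e.
Proof.
move=> e0 AB i j; rewrite -mxdiagB !mxE.
case: eqP => [eq_k|_]; last by rewrite mxE normr0.
move: (tagnat.sig2 j); rewrite -eq_k => l.
by rewrite conform_mx_id !mxE.
Qed.

Lemma mxcol_bound (n : nat) (q : 'I_n -> nat) (a b : forall k, 'cV[R]_(q k)) e :
    (forall k i, `|a k i 0 - b k i 0| <= e) ->
  forall i, absmx (mxcol a - mxcol b) i 0 <= e.
Proof. by move=> ab i; rewrite -mxcolB !mxE. Qed.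

Lemma entry_le_sum m n (A : 'M[R]_(m, n)) i j : (forall k l, 0 <= A k l) ->
  A i j <= \sum_k \sum_l A k l.
Proof.
move=> A0; rewrite (bigD1 i) //= (bigD1 j) //= -addrA lerDl.
by rewrite addr_ge0 ?sumr_ge0 // => k _; rewrite sumr_ge0.
Qed.

End Blocks.

(** * Local tensors *)

Section LocalTensors.
Variables (R : realFieldType) (f : weak_form) (sh : cell_shape) (d p nq nK : nat).
Variables (E : reference R sh d p nq) (K : 'I_nK -> cell R sh d p).
Hypothesis K_nondegenerate : forall k, nondegenerate_cell E (K k).
Variables (r : nat) (cinv : nat -> R).
Notation nphi := (space_dim sh d p).

(** The last bound is the one on [roundoff_s] as a precision of its own, so that
    the four precisions are used in the same way. *)
Record roundoffs := Roundoffs {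
  roundoff_p : R; roundoff_g : R; roundoff_q : R; roundoff_s : R;
  roundoff_le : [/\ 0 <= roundoff_p <= roundoff_s,
    0 <= roundoff_g <= roundoff_s, 0 <= roundoff_q <= roundoff_s &
    0 <= roundoff_s <= roundoff_s]
}.

(** The runs are all choices of unit roundoffs with all possible computed
    matrices, which makes the constants independent of both. *)
Lemma local_matrices_error : exists C u0, [/\ 0 <= C, 0 < u0 &
  forall (U : roundoffs) (A : 'I_nK -> 'M[R]_nphi),
    (forall k, fl_local_matrix f E (K k) r cinv (roundoff_p U)
       (roundoff_g U) (roundoff_q U) (roundoff_s U) (A k)) ->
    roundoff_s U <= u0 ->
    forall k i j, `|A k i j - local_matrix f E (K k) i j| <= C * roundoff_s U].
Proof.
pose T := {w : roundoffs * ('I_nK -> 'M[R]_nphi) | forall k,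
  fl_local_matrix f E (K k) r cinv (roundoff_p w.1)
    (roundoff_g w.1) (roundoff_q w.1) (roundoff_s w.1) (w.2 k)}.
pose u (t : T) := roundoff_s (sval t).1.
have [C [u0 [C0 u00 H]]] := accurate_uniform (I := ('I_nK * 'I_nphi * 'I_nphi)%type)
  (F := fun a (t : T) => (sval t).2 a.1.1 a.1.2 a.2) (u := u)
  (X := fun a => local_matrix f E (K a.1.1) a.1.2 a.2)
  (fun a => accurate_fl_local_matrix
     (vp := fun t : T => roundoff_p (sval t).1)
     (vg := fun t => roundoff_g (sval t).1)
     (vq := fun t => roundoff_q (sval t).1) (vs := u)
     (fun t => let: And4 h _ _ _ := roundoff_le (sval t).1 in h)
     (fun t => let: And4 _ h _ _ := roundoff_le (sval t).1 in h)
     (fun t => let: And4 _ _ h _ := roundoff_le (sval t).1 in h)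
     (fun t => let: And4 _ _ _ h := roundoff_le (sval t).1 in h)
     (@K_nondegenerate a.1.1) (fun t => svalP t a.1.1) a.1.2 a.2).
exists C, u0; split=> // U A UA U0 k i j.
apply: (H (exist _ (U, A) UA) _ (k, i, j)).
by case: (roundoff_le U) => _ _ _ /andP[s0 _]; rewrite /u /= s0.
Qed.

Lemma local_vectors_error : exists C u0, [/\ 0 <= C, 0 < u0 &
  forall (U : roundoffs) (g : 'I_nK -> 'cV[R]_nphi),
    (forall k, fl_local_vector f E (K k) r cinv (roundoff_p U)
       (roundoff_g U) (roundoff_q U) (roundoff_s U) (g k)) ->
    roundoff_s U <= u0 ->
    forall k i, `|g k i 0 - local_vector f E (K k) i 0| <= C * roundoff_s U].
Proof.
pose T := {w : roundoffs * ('I_nK -> 'cV[R]_nphi) | forall k,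
  fl_local_vector f E (K k) r cinv (roundoff_p w.1)
    (roundoff_g w.1) (roundoff_q w.1) (roundoff_s w.1) (w.2 k)}.
pose u (t : T) := roundoff_s (sval t).1.
have [C [u0 [C0 u00 H]]] := accurate_uniform (I := ('I_nK * 'I_nphi)%type)
  (F := fun a (t : T) => (sval t).2 a.1 a.2 0) (u := u)
  (X := fun a => local_vector f E (K a.1) a.2 0)
  (fun a => accurate_fl_local_vector
     (vp := fun t : T => roundoff_p (sval t).1)
     (vg := fun t => roundoff_g (sval t).1)
     (vq := fun t => roundoff_q (sval t).1) (vs := u)
     (fun t => let: And4 h _ _ _ := roundoff_le (sval t).1 in h)
     (fun t => let: And4 _ h _ _ := roundoff_le (sval t).1 in h)
     (fun t => let: And4 _ _ h _ := roundoff_le (sval t).1 in h)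
     (fun t => let: And4 _ _ _ h := roundoff_le (sval t).1 in h)
     (@K_nondegenerate a.1) (fun t => svalP t a.1) a.2 0).
exists C, u0; split=> // U g UA U0 k i.
apply: (H (exist _ (U, g) UA) _ (k, i)).
by case: (roundoff_le U) => _ _ _ /andP[s0 _]; rewrite /u /= s0.
Qed.

End LocalTensors.

Lemma absmx_subadd (R : realFieldType) m n (A B : 'M[R]_(m, n)) i j :
  absmx A i j <= (absmx B + absmx (A - B)) i j.
Proof.
rewrite !mxE -{1}[A i j](subrK (B i j)) addrC.
by apply: le_trans (ler_normD _ _) _.
Qed.

(** * The global error bound *)

Theorem corollary4p11 (R : realFieldType) (f : weak_form) (sh : cell_shape)
    (d p nq nK ng mK : nat) (d_gt0 : (0 < d)%N)
    (E : reference R sh d p nq) (K : 'I_nK -> cell R sh d p)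
    (K_nondegenerate : forall k, nondegenerate_cell E (K k))
    (r : nat) (cinv : nat -> R)
    (L : 'M[R]_(ng, \sum_(k < nK) space_dim sh d p))
    (L_bool : boolean_assembly L)
    (L_row : forall i, (#|[set j | L i j != 0%R]| <= mK)%N)
    (c : R) (c_gt0 : 0 < c) :
  let D := \mxdiag_(k < nK) local_matrix f E (K k) in
  let b := \mxcol_(k < nK) local_vector f E (K k) in
  let Ag := L *m D *m L^T in
  let vg := L *m b in
  exists2 C : R, 0 < C & exists2 u0 : R, 0 < u0 &
    forall up ug uq us : R,
      0 < up -> 0 < ug -> 0 < uq -> 0 < us ->
      Num.max up (Num.max ug uq) <= us -> us <= u0 ->
      gamma mK uq <= c * mK%:R * uq ->
      (forall (Ah : 'I_nK -> 'M[R]_(space_dim sh d p)) (Agh : 'M[R]_ng),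
         (forall k, fl_local_matrix f E (K k) r cinv up ug uq us (Ah k)) ->
         let Dh := \mxdiag_(k < nK) Ah k in
         fl_assemble uq L Dh Agh ->
         forall i j,
           `|Agh i j - Ag i j| <=
             (L *m absmx (Dh - D) *m L^T) i j
             + 2 * c * mK%:R * uq * (L *m absmx D *m L^T) i j
             + C * (uq * (us + uq + ug + up))) /\
      (forall (vh : 'I_nK -> 'cV[R]_(space_dim sh d p)) (vgh : 'cV[R]_ng),
         (forall k, fl_local_vector f E (K k) r cinv up ug uq us (vh k)) ->
         let bh := \mxcol_(k < nK) vh k in
         fl_boolmul uq L bh vgh ->
         forall i,
           `|vgh i 0 - vg i 0| <=
             (L *m absmx (bh - b)) i 0
             + c * mK%:R * uq * (L *m absmx b) i 0
             + C * (uq * (us + uq + ug + up))).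
Proof.
move=> D b Ag vg.
have [CA [uA [CA0 uA0 HA]]] := local_matrices_error f K_nondegenerate r cinv.
have [Cb [ub [Cb0 ub0 Hb]]] := local_vectors_error f K_nondegenerate r cinv.
have L0 := assembly_ge0 L_bool.
pose N0 := c * mK%:R.
have c0 := ltW c_gt0.
have N00 : 0 <= N0 by rewrite mulr_ge0.
(* The matrix norms that occur are bounded by the sums of all entries, and
   [L |Dh - D| L^T] by its value for a constant matrix. *)
pose XA := \sum_i \sum_j (L *m absmx D *m L^T) i j.
pose WA := \sum_i \sum_j (L *m const_mx 1 *m L^T) i j.
pose Wb := \sum_i \sum_j (L *m (const_mx 1 : 'cV_ _)) i j.
have XA0 : 0 <= XA.
  do 2![apply: sumr_ge0 => ? _]; apply: (assemble_ge0 L_bool) => k l.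
  by rewrite mxE.
have WA0 : 0 <= WA.
  do 2![apply: sumr_ge0 => ? _]; apply: (assemble_ge0 L_bool) => k l.
  by rewrite mxE.
have Lc0 i j : 0 <= (L *m (const_mx 1 : 'cV_ _)) i j.
  by rewrite mxE sumr_ge0 // => k _; rewrite mulr_ge0 // mxE.
have Wb0 : 0 <= Wb by do 2![apply: sumr_ge0 => ? _].
(* [C1] collects [gamma^2 L |D| L^T] and [(2 gamma + gamma^2) L |Dh - D| L^T],
   and [C2] collects [gamma L |bh - b|]. *)
pose C1 := N0 ^+ 2 * XA + (2 * N0 + N0 ^+ 2) * (CA * WA).
pose C2 := N0 * (Cb * Wb).
have C10 : 0 <= C1.
  have N20 : 0 <= N0 ^+ 2 by rewrite exprn_ge0.
  by apply: addr_ge0; apply: mulr_ge0; rewrite ?addr_ge0 ?mulr_ge0.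
have C20 : 0 <= C2 by rewrite /C2 !mulr_ge0.
exists (1 + C1 + C2); first by lra.
(* Below [m1] all unit roundoffs are at most 1, and [gamma mK] makes sense. *)
pose m1 := (mK%:R + 1)^-1 : R.
have mK0 : 0 <= mK%:R :> R by exact: ler0n.
exists (Num.min m1 (Num.min uA ub)).
  by rewrite !lt_min uA0 ub0 invr_gt0; lra.
move=> up ug uq us up0 ug0 uq0 us0.
rewrite !ge_max !le_min => /and3P[ps gs qs] /and3P[s1 sA sb] gN.
have le_u : [/\ 0 <= up <= us, 0 <= ug <= us, 0 <= uq <= us & 0 <= us <= us].
  by rewrite ps gs qs lexx !ltW.
pose U := Roundoffs le_u.
have {}s1 : us * (mK%:R + 1) <= 1 by rewrite -ler_pdivlMr ?div1r //; lra.
have mKuq : mK%:R * uq < 1 by nra.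
have us1 : us <= 1 by nra.
have uq0' := ltW uq0; have us0' := ltW us0.
have g0 := gamma_ge0 uq0' mKuq.
set g := gamma mK uq in gN g0.
have Nuq : 0 <= N0 * uq by rewrite mulr_ge0.
have S0 : uq * us <= uq * (us + uq + ug + up) by rewrite ler_pM2l //; lra.
have S00 : 0 <= uq * us by rewrite mulr_ge0.
split=> [Ah Agh HAh Dh HAgh i j|vh vgh Hvh bh Hvgh i].
  set X := (L *m absmx D *m L^T) i j; set Y := (L *m absmx (Dh - D) *m L^T) i j.
  have X0 : 0 <= X by apply: (assemble_ge0 L_bool) => k l; rewrite mxE.
  have Y0 : 0 <= Y by apply: (assemble_ge0 L_bool) => k l; rewrite mxE.
  have XXA : X <= XA.
    apply: entry_le_sum => k l; apply: (assemble_ge0 L_bool) => *.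
    by rewrite mxE.
  have YWA : Y <= CA * us * WA.
    have e0 : 0 <= CA * us by rewrite mulr_ge0.
    apply: (@le_trans _ _ (CA * us * (L *m const_mx 1 *m L^T) i j)).
      rewrite (_ : CA * us * _ = (L *m (CA * us *: const_mx 1) *m L^T) i j).
        apply: (assemble_le L_bool) => k l; rewrite [leRHS]mxE [X in _ * X]mxE mulr1.
        by apply: mxdiag_bound => // q k' l'; apply: (HA U).
      by rewrite -scalemxAr -scalemxAl [RHS]mxE.
    rewrite ler_wpM2l //; apply: entry_le_sum => k l.
    by apply: (assemble_ge0 L_bool) => *; rewrite mxE.
  have Z : (L *m absmx Dh *m L^T) i j <= X + Y.
    have -> : X + Y = (L *m (absmx D + absmx (Dh - D)) *m L^T) i j.
      by rewrite mulmxDr mulmxDl [RHS]mxE.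
    by apply: (assemble_le L_bool) => k l; apply: absmx_subadd.
  have E1 : `|Agh i j - (L *m Dh *m L^T) i j| <= (2 * g + g ^+ 2) * (X + Y).
    apply: le_trans (fl_assemble_err uq0' mKuq L_bool L_row i j HAgh) _.
    by rewrite ler_wpM2l // addr_ge0 ?exprn_ge0 // mulr_ge0.
  have E2 : `|(L *m Dh *m L^T) i j - Ag i j| <= Y.
    have -> : (L *m Dh *m L^T) i j - Ag i j = (L *m (Dh - D) *m L^T) i j.
      by rewrite mulmxBr mulmxBl !mxE.
    exact: assemble_norm.
  set n := N0 * uq in gN Nuq.
  have gn : (2 * g + g ^+ 2) * (X + Y) <= (2 * n + n ^+ 2) * (X + Y).
    by rewrite ler_wpM2r ?addr_ge0 // lerD ?ler_wpM2l // lerXn2r.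
  have nX : n ^+ 2 * X <= N0 ^+ 2 * XA * (uq * us).
    rewrite (_ : n ^+ 2 * X = N0 ^+ 2 * (uq * (uq * X))); last by rewrite /n; ring.
    rewrite (_ : N0 ^+ 2 * XA * _ = N0 ^+ 2 * (uq * (us * XA))); last by ring.
    by rewrite ler_wpM2l ?exprn_ge0 // ler_wpM2l // ler_pM.
  have nY : (2 * n + n ^+ 2) * Y <= (2 * N0 + N0 ^+ 2) * (CA * WA) * (uq * us).
    have nn : 2 * n + n ^+ 2 <= (2 * N0 + N0 ^+ 2) * uq.
      rewrite /n (mulrDl (2 * N0)) -(mulrA 2) lerD // exprMn ler_wpM2l ?exprn_ge0 // expr2.
      by rewrite ler_piMr // (le_trans _ us1).
    rewrite [leRHS](_ : _ = (2 * N0 + N0 ^+ 2) * uq * (CA * us * WA)); last by ring.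
    rewrite ler_pM // addr_ge0 ?exprn_ge0 // mulr_ge0 //.
  rewrite -[Agh i j](subrK ((L *m Dh *m L^T) i j)) -addrA.
  apply: le_trans (ler_normD _ _) _.
  apply: le_trans (lerD E1 E2) _.
  rewrite (_ : 2 * c * mK%:R * uq * X = 2 * n * X); last by rewrite /n /N0; ring.
  have CQ := ler_wpM2l C10 S0.
  have C2Q := mulr_ge0 C20 (le_trans S00 S0).
  have Q0 := le_trans S00 S0.
  rewrite /C1 mulrDl -/C1 in CQ; rewrite (mulrDl _ C2) (mulrDl 1 C1) mul1r; lra.
set X : R := (L *m absmx b) i 0; set Y : R := (L *m absmx (bh - b)) i 0.
have X0 : 0 <= X by rewrite /X mxE sumr_ge0 // => k _; rewrite mxE mulr_ge0.
have Y0 : 0 <= Y by rewrite /Y mxE sumr_ge0 // => k _; rewrite mxE mulr_ge0.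
have YWb : Y <= Cb * us * Wb.
  have e0 : 0 <= Cb * us by rewrite mulr_ge0.
  apply: (@le_trans _ _ (Cb * us * (L *m (const_mx 1 : 'cV_ _)) i 0)).
    rewrite (_ : Cb * us * _ = (L *m (Cb * us *: (const_mx 1 : 'cV_ _))) i 0).
      apply: (assembly_le L_bool) => k; rewrite [leRHS]mxE [X in _ * X]mxE mulr1.
      by apply: mxcol_bound => q k'; apply: (Hb U).
    by rewrite -scalemxAr [RHS]mxE.
  by rewrite ler_wpM2l //; apply: entry_le_sum.
have Z : (L *m absmx bh) i 0 <= X + Y.
  have -> : X + Y = (L *m (absmx b + absmx (bh - b))) i 0.
    by rewrite mulmxDr [RHS]mxE.
  by apply: (assembly_le L_bool) => k; apply: absmx_subadd.
have E1 : `|vgh i 0 - (L *m bh) i 0| <= g * (X + Y).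
  apply: le_trans (fl_boolmul_err uq0' mKuq L_bool L_row i 0 Hvgh) _.
  by rewrite ler_wpM2l.
have E2 : `|(L *m bh) i 0 - vg i 0| <= Y.
  have -> : (L *m bh) i 0 - vg i 0 = (L *m (bh - b)) i 0.
    by rewrite mulmxBr !mxE.
  exact: assembly_norm.
have gn : g * (X + Y) <= N0 * uq * (X + Y) by rewrite ler_wpM2r ?addr_ge0.
have nY : N0 * uq * Y <= C2 * (uq * us).
  rewrite [leRHS](_ : _ = N0 * uq * (Cb * us * Wb)); last by rewrite /C2; ring.
  by rewrite ler_wpM2l.
rewrite -[vgh i 0](subrK ((L *m bh) i 0)) -addrA.
apply: le_trans (ler_normD _ _) _.
apply: le_trans (lerD E1 E2) _.
rewrite -/N0.
have CQ := ler_wpM2l C20 S0.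
have C1Q := mulr_ge0 C10 (le_trans S00 S0).
have Q0 := le_trans S00 S0.
rewrite (mulrDl _ C2) (mulrDl 1 C1) mul1r; lra.
Qed.
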